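(* Let $d\ge 1$, $0<q<1$, $s\ge 0$, and let $\mathcal{B}=\ell^q_{v_s}(\mathbb{Z}^d)$. Then the following are equivalent: (i) $\mathcal{B}$ is inverse-closed in $B(\ell^2)$, where $a\in\mathcal{B}$ is identified with the convolution operator $C_a b=a\ast b$ on $\ell^2(\mathbb{Z}^d)$. (ii) $\mathcal{C}_{\mathcal{B}}$ is inverse-closed in $B(\ell^2)$. (iii) The spectrum satisfies $\widehat{\mathcal{B}}\simeq\mathbb{T}^d$.
   Context: Let $v_s(k)=(1+|k|)^s$. The space $\ell^q_{v_s}(\mathbb{Z}^d)$ consists of all complex sequences $a=(a(k))_{k\in\mathbb{Z}^d}$ with $\|a\|_{\ell^q_{v_s}}=\big(\sum_{k}|a(k)|^q v_s(k)^q\big)^{1/q}<\infty$. For $0<q\le1$, $s\ge0$ it is contained in $\ell^1(\mathbb{Z}^d)$ and is a commutative quasi-Banach algebra under convolution, with unit $\delta$ ($\delta(0)=1$, $\delta(k)=0$ for $k\ne0$). $B(\ell^2)$ is the algebra of bounded linear operators on $\ell^2(\mathbb{Z}^d)$. An element $a\in\mathcal{B}\subset\ell^1$ is identified with $C_a\in B(\ell^2)$, $C_ab=a\ast b$. For a complex matrix $A=(a_{k,j})_{k,j\in\mathbb{Z}^d}$ put $d_A(n)=\sup_{k\in\mathbb{Z}^d}|a_{k,k-n}|$, $n\in\mathbb{Z}^d$. Then $A\in\mathcal{C}_{\mathcal{B}}$ if and only if $d_A\in\mathcal{B}$, with $\|A\|_{\mathcal{C}_{\mathcal{B}}}=\|d_A\|_{\mathcal{B}}$.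 $\mathcal{C}_{\mathcal{B}}$ is a quasi-Banach algebra under matrix multiplication and is identified with a subalgebra of $B(\ell^2)$ (matrices acting on $\ell^2(\mathbb{Z}^d)$). If $\mathcal{B}_1\subseteq\mathcal{A}$ are two quasi-Banach algebras with common unit, $\mathcal{B}_1$ is inverse-closed in $\mathcal{A}$ if $b\in\mathcal{B}_1$ and $b^{-1}\in\mathcal{A}$ imply $b^{-1}\in\mathcal{B}_1$. $\widehat{\mathcal{B}}$ is the set of complex homomorphisms of $\mathcal{B}$, i.e. of nonzero linear maps $\phi:\mathcal{B}\to\mathbb{C}$ with $\phi(a\ast b)=\phi(a)\phi(b)$. Since $\mathcal{B}\subset\ell^1(\mathbb{Z}^d)$, each $t\in\mathbb{T}^d=\mathbb{R}^d/\mathbb{Z}^d$ gives an element $a\mapsto\sum_{n\in\mathbb{Z}^d}a(n)e^{2\pi i n\cdot t}$ of $\widehat{\mathcal{B}}$, so $\mathbb{T}^d\subseteq\widehat{\mathcal{B}}$; $\widehat{\mathcal{B}}\simeq\mathbb{T}^d$ means that every element of $\widehat{\mathcal{B}}$ is of this form. *)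

(* Defs.v *)
From HB Require Import structures.
From mathcomp Require Import all_boot all_order all_algebra.
From mathcomp Require Import all_classical all_reals all_analysis.
From mathcomp.analysis.showcase Require summability.
From mathcomp Require Import complex.

Set Implicit Arguments.
Unset Strict Implicit.
Unset Printing Implicit Defensive.

Import Order.TTheory GRing.Theory Num.Theory numFieldNormedType.Exports.

Local Open Scope classical_set_scope.
Local Open Scope ring_scope.

(* The regular algebra R[i]^o is used for the field of scalars so that
   sequences form a module over R[i] and limits are taken in its norm topology. *)
Notation cseq R d := ('rV[int]_d -> (R[i]^o)%type).

(* Unordered sum: the limit of the partial sums over finite sets of indices;
   every series below converges absolutely in the intended use. *)
Definition csum (R : realType) (d : nat) (f : cseq R d) : R[i]^o :=
  summability.sum f.

Definition euclid (R : realType) (d : nat) (k : 'rV[int]_d) : R :=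
  Num.sqrt (\sum_i ((k 0 i)%:~R : R) ^+ 2).

Definition weight (R : realType) (d : nat) (s : R) (k : 'rV[int]_d) : R :=
  (1 + euclid R k) `^ s.

Definition ellnorm (R : realType) (d : nat) (q s : R) (a : cseq R d) : \bar R :=
  ((\esum_(k in [set: 'rV[int]_d])
     (Normc.normc (a k) `^ q * weight s k `^ q)%:E) `^ q^-1)%E.

Definition ell (R : realType) (d : nat) (q s : R) : set (cseq R d) :=
  [set a | (ellnorm q s a < +oo)%E].
Arguments ell {R} d q s.

Definition conv (R : realType) (d : nat) (a b : cseq R d) : cseq R d :=
  fun n => csum (fun k => a k * b (n - k)).

Definition mxact (R : realType) (d : nat)
    (A : 'rV[int]_d -> 'rV[int]_d -> R[i]) (b : cseq R d) : cseq R d :=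
  fun k => csum (fun j => A k j * b j).

Section ell_submod.
Context (R : realType) (d : nat) (q s : R).
Hypothesis q0 : 0 < q.
Local Notation term a k :=
  ((Normc.normc (a k) `^ q * weight s k `^ q)%:E : \bar R).

Let term_ge0 (a : cseq R d) k : (0 <= term a k)%E.
Proof. by rewrite lee_fin mulr_ge0 ?powR_ge0. Qed.

Lemma ellE (a : cseq R d) :
  ell d q s a <-> (\esum_(k in [set: 'rV[int]_d]) term a k < +oo)%E.
Proof.
rewrite /ell /= /ellnorm; split; last exact: poweR_lty.
by apply: lty_poweRy; rewrite invr_eq0 gt_eqF.
Qed.

Let normc_ge0 (x : R[i]) : 0 <= Normc.normc x.
Proof. by case: x => x y; exact: sqrtr_ge0. Qed.

Let powRD_le (x y : R) : 0 <= x -> 0 <= y ->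
  (x + y) `^ q <= 2 `^ q * (x `^ q + y `^ q).
Proof.
move=> x0 y0.
wlog xy : x y x0 y0 / x <= y.
  move=> H; have [|/ltW yx] := leP x y; first exact: H.
  by rewrite addrC [x `^ q + _]addrC; exact: H.
apply: (@le_trans _ _ ((2 * y) `^ q)).
  apply: ge0_ler_powR; rewrite ?nnegrE; [exact: ltW| | |].
  - exact: addr_ge0.
  - exact: mulr_ge0.
  - by rewrite mulr_natl mulr2n lerD2r.
by rewrite powRM// ler_wpM2l ?powR_ge0// lerDr powR_ge0.
Qed.

Let le_esumMl (M : R) (f : 'rV[int]_d -> \bar R) : 0 <= M ->
  (forall k, 0 <= f k)%E ->
  (\esum_(k in [set: 'rV[int]_d]) (M%:E * f k) <=
   M%:E * \esum_(k in [set: 'rV[int]_d]) f k)%E.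
Proof.
move=> M0 f0; apply: ge_ereal_sup => _ [A [finA _] <-].
rewrite -ge0_mule_fsumr//; apply: lee_wpmul2l; first by rewrite lee_fin.
by apply: ereal_sup_ubound; exists A.
Qed.

Lemma ell_submod_closed : submod_closed (mem (ell d q s)).
Proof.
split.
  rewrite inE; apply/ellE; rewrite esum1// => k _.
  by rewrite [X in Normc.normc X]/(0 : R[i]) Normc.normc0 powR0 ?mul0r// gt_eqF.
move=> c a b; rewrite !inE => /ellE aq /ellE bq; apply/ellE.
set M := 2 `^ q * Num.max 1 (Normc.normc c `^ q).
have M0 : 0 <= M by rewrite mulr_ge0 ?powR_ge0// le_max ler01.
apply: (@le_lt_trans _ _
  (\esum_(k in [set: 'rV[int]_d]) (M%:E * (term a k + term b k)))%E).
  apply: le_esum => k _; rewrite -EFinD -EFinM lee_fin -mulrDl mulrA.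
  apply: ler_wpM2r; first exact: powR_ge0.
  apply: (@le_trans _ _ ((Normc.normc (c * a k) + Normc.normc (b k)) `^ q)).
    apply: ge0_ler_powR; rewrite ?nnegrE; [exact: ltW|by []| |].
    - exact: addr_ge0.
    - exact: le_normcD.
  apply: (le_trans (powRD_le _ _)) => //.
  rewrite -mulrA ler_wpM2l ?powR_ge0// mulrDr lerD//.
    by rewrite Normc.normcM powRM// ler_wpM2r ?powR_ge0// le_max lexx orbT.
  by rewrite ler_peMl ?powR_ge0// le_max lexx.
apply: (le_lt_trans (le_esumMl _ _)) => // [k|]; first by rewrite adde_ge0.
rewrite esumD//; apply: lte_mul_pinfty; rewrite ?lee_fin//.
exact: lte_add_pinfty.
Qed.

End ell_submod.

Section ell_space.
Context (R : realType) (d : nat) (q : {posnum R}) (s : R).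

Definition ellpred : {pred cseq R d} := mem (ell d q%:num s).

HB.instance Definition _ := GRing.isSubmodClosed.Build _ _ ellpred
  (ell_submod_closed d s (gt0 q)).

Record ellspace := EllSpace {
  ellval :> cseq R d;
  ellvalP : ellval \in ellpred }.

HB.instance Definition _ := [isSub for ellval].
HB.instance Definition _ := [Choice of ellspace by <:].
HB.instance Definition _ := [SubChoice_isSubLmodule of ellspace by <:].

End ell_space.

Definition pos2 (R : realType) : {posnum R} := 2%:pos.

Notation ell2 R d := (ellspace d (pos2 R) 0).

(* B(l^2) *)
Definition bounded_ops (R : realType) (d : nat) : set (ell2 R d -> ell2 R d) :=
  [set T : ell2 R d -> ell2 R d | linear T /\
    exists M : R, forall x, (ellnorm 2 0 (T x) <= M%:E * ellnorm 2 0 x)%E].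
Arguments bounded_ops R d _ : clear implicits.

(* Inverse-closedness for algebras whose elements are self-maps of V, with
   composition as product and the identity map as unit. *)
Definition inverse_closed (V : Type) (B1 A : set (V -> V)) : Prop :=
  forall T S, B1 T -> A S -> cancel T S -> cancel S T -> B1 S.

(* The algebra B of sequences, identified with the operators C_a, a in B. *)
Definition conv_ops (R : realType) (d : nat) (B : set (cseq R d)) :
    set (ell2 R d -> ell2 R d) :=
  [set T : ell2 R d -> ell2 R d | exists2 a, B a & forall x, T x = conv a x :> cseq R d].

(* [sup] is 0 on unbounded sets, hence the separate requirement that the
   suprema defining d_A are finite. *)
Definition convdom (R : realType) (d : nat) (B : set (cseq R d)) :
    set ('rV[int]_d -> 'rV[int]_d -> R[i]) :=
  [set A | let diag n := range (fun k => Normc.normc (A k (k - n))) in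
    (forall n, has_ubound (diag n)) /\ B (fun n => ((sup (diag n))%:C)%C)].

(* C_B, identified with the operators on l^2 given by its matrices. *)
Definition convdom_ops (R : realType) (d : nat) (B : set (cseq R d)) :
    set (ell2 R d -> ell2 R d) :=
  [set T : ell2 R d -> ell2 R d | exists2 A, convdom B A & forall x, T x = mxact A x :> cseq R d].

(* The product a * b is given by its graph (c = a * b), since a, b and c
   are elements of the type of l^q_s. *)
Definition spectrum (R : realType) (d : nat) (q : {posnum R}) (s : R) :
    set (ellspace d q s -> R[i]) :=
  [set phi : ellspace d q s -> R[i] | [/\ scalar phi,
    forall a b c : ellspace d q s,
      c = conv a b :> cseq R d -> phi c = phi a * phi b &
    exists a, phi a != 0]].

Definition expi (R : realType) (x : R) : R[i] := (cos x +i* sin x)%C.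

(* The point of T^d = R^d / Z^d is given by a representative t in R^d. *)
Definition torus_char (R : realType) (d : nat) (q : {posnum R}) (s : R)
    (t : 'rV[R]_d) : ellspace d q s -> R[i] :=
  fun a => csum (fun n => a n * expi (2 * pi * \sum_i (n 0 i)%:~R * t 0 i)).
Arguments torus_char {R d} q s t.
Arguments spectrum {R} d q s _.

(* Main.v *)
(** All three properties hold for every [q < 1]; each is proved outright.

    Matrices.  Let [S] invert the matrix [A] on l^2 and let [D] be the profile
    d_A.  The bumps [spike r p k = r ^ |k - p|] vary slowly relative to their own
    size, so the commutator of [A] with the bump at [p] is controlled by the
    weights [c l = D l * (1 - r ^ |l|)], whose quasi-norm in l^q_v tends to 0 as
    [r -> 1].  Writing [alpha p] for the l^2 norm of the bump at [p] times a column
    [S e_j], boundedness of [S] yields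
      [alpha p <= C * (r ^ |j - p| + sum_l c l * (alpha p + alpha (p - l)))],
    and iterating this contraction bounds [|S e_j (i)|] by an l^q_v function of
    [i - j] (this is Sjostrand's proof of Wiener's lemma for matrices).  Convolution
    operators are the special case of matrices commuting with translations.

    Characters.  A Neumann series shows [|phi a| ^ q <= 2 * ||a|| ^ q], hence
    [phi (delta_k)] grows at most polynomially in [k]; being multiplicative in [k] it
    has modulus one, so [phi] agrees with a point of the torus on finitely supported
    sequences, which are dense. *)
Require Import Defs.
From mathcomp Require Import all_boot all_order all_algebra finmap.
From mathcomp Require Import all_classical all_reals all_analysis.
From mathcomp.analysis.showcase Require summability.
From mathcomp Require Import complex ring lra.

Set Implicit Arguments.
Unset Strict Implicit.
Unset Printing Implicit Defensive.

Import Order.TTheory GRing.Theory Num.Theory numFieldNormedType.Exports.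
Import Normc.

Local Open Scope classical_set_scope.
Local Open Scope ring_scope.

#[local] Arguments normc : simpl never.

(** * Bounded sums of nonnegative families *)

Section bounded_sums.
Variable R : realType.

(** Summability and an upper bound in one predicate: for nonnegative [f] it says that the series
    converges with sum at most [M], phrased through finite partial sums. *)
Definition bsum (T : choiceType) (f : T -> R) (M : R) : Prop :=
  forall F : {fset T}, \sum_(k <- F) f k <= M.

(** For nonnegative [f] this is the sum of the series as soon as some [bsum] bound holds; on an
    unbounded set [sup] falls back to 0. *)
Definition tsum (T : choiceType) (f : T -> R) : R :=
  sup (range (fun F : {fset T} => \sum_(k <- F) f k)).

Section one_index.
Variable T : choiceType.
Implicit Types (f g : T -> R) (F G : {fset T}).

Lemma bsum_ge0 f M : bsum f M -> 0 <= M.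
Proof. by move/(_ fset0); rewrite big_seq_fset0. Qed.

Lemma bsum_term f M k : bsum f M -> f k <= M.
Proof. by move/(_ [fset k]%fset); rewrite big_seq_fset1. Qed.

Lemma le_bsum f g M : (forall k, f k <= g k) -> bsum g M -> bsum f M.
Proof. by move=> fg gM F; apply: le_trans (gM F); apply: ler_sum. Qed.

Lemma bsum_le f M N : M <= N -> bsum f M -> bsum f N.
Proof. by move=> MN fM F; exact: le_trans (fM F) MN. Qed.

Lemma bsumD f g M N : bsum f M -> bsum g N -> bsum (fun k => f k + g k) (M + N).
Proof. by move=> fM gN F; rewrite big_split lerD. Qed.

Lemma bsumZ c f M : 0 <= c -> bsum f M -> bsum (fun k => c * f k) (c * M).
Proof. by move=> c0 fM F; rewrite -mulr_sumr ler_wpM2l. Qed.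

Lemma ler_sum_fsubset f F G : (forall k, 0 <= f k) -> (F `<=` G)%fset ->
  \sum_(k <- F) f k <= \sum_(k <- G) f k.
Proof.
move=> f0 /fsubsetP FG; rewrite [leRHS](big_fsetID _ (mem F))/=.
rewrite (_ : [fset x | x in G & x \in F]%fset = F) ?lerDl ?sumr_ge0//.
by apply/fsetP => x; rewrite !inE/= andbC; case: (boolP (x \in F)) => // /FG.
Qed.

Lemma sum_fsetUD f F G : \sum_(k <- (F `|` G)%fset) f k =
  \sum_(k <- F) f k + \sum_(k <- (G `\` F)%fset) f k.
Proof.
rewrite (big_fsetID _ (mem F))/=; congr (_ + _); apply: eq_fbigl => x.
  by rewrite !inE/= andbC; case: (x \in F).
by rewrite !inE/= andbC; case: (x \in F).
Qed.

Lemma tsum_le f M : bsum f M -> tsum f <= M.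
Proof.
move=> fM; apply: ge_sup => [|_ [F _ <-]]; last exact: fM.
by exists (\sum_(k <- fset0) f k); exists fset0.
Qed.

Lemma bsum_tsum f M : bsum f M -> bsum f (tsum f).
Proof.
move=> fM F; apply: ub_le_sup; last by exists F.
by exists M => _ [G _ <-]; exact: fM.
Qed.

Lemma tsum_ge0 f M : bsum f M -> 0 <= tsum f.
Proof. by move/bsum_tsum/bsum_ge0. Qed.

(** Finite sets that nearly exhaust the two series are merged into their union, where the joint
    bound applies. *)
Lemma tsumD_le f g M : (forall k, 0 <= f k) -> (forall k, 0 <= g k) ->
  bsum (fun k => f k + g k) M -> tsum f + tsum g <= M.
Proof.
move=> f0 g0 fgM; rewrite -lerBrDr; apply: tsum_le => F.
rewrite lerBrDl -lerBrDr; apply: tsum_le => G.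
rewrite lerBrDl; apply: le_trans (fgM (F `|` G)%fset).
by rewrite big_split lerD// ler_sum_fsubset// (fsubsetUl, fsubsetUr).
Qed.

Lemma tsum_approx f M e : bsum f M -> 0 < e ->
  exists F, tsum f - e < \sum_(k <- F) f k.
Proof.
move=> fM e0; have [|_ [F _ <-] Fe] := @sup_adherent _ _ _ e0 (_ : has_sup
    (range (fun F : {fset T} => \sum_(k <- F) f k))); last by exists F.
split; first by exists (\sum_(k <- fset0) f k); exists fset0.
by exists M => _ [G _ <-]; exact: fM.
Qed.

(** A finite set whose sum comes within [e] of the total leaves at most [e] for any finite set
    disjoint from it. *)
Lemma bsum_tail f M e : (forall k, 0 <= f k) -> bsum f M -> 0 < e ->
  exists F, bsum (fun k => if k \in F then 0 else f k) e.
Proof.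
move=> f0 fM e0; have fb := bsum_tsum fM; have [F Fe] := tsum_approx fM e0.
exists F => G; have := fb (F `|` G)%fset; rewrite sum_fsetUD.
suff -> : \sum_(k <- (G `\` F)%fset) f k = \sum_(k <- G) (if k \in F then 0 else f k).
  move: Fe; set x := \sum_(k <- F) _; set y := \sum_(k <- G) _; lra.
rewrite [RHS](big_fsetID _ (mem F))/= [X in X + _]big1_seq ?add0r; last first.
  by move=> i; rewrite !inE/= => /andP[_ ->].
rewrite (_ : [fset x | x in G & x \notin F]%fset = (G `\` F)%fset); last first.
  by apply/fsetP => x; rewrite !inE/= andbC.
by rewrite big_seq [RHS]big_seq; apply: eq_bigr => i; rewrite !inE => /andP[/negPf->].
Qed.

End one_index.

Lemma bsum_inj (T T' : choiceType) (e : T' -> T) (f : T -> R) M :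
  injective e -> bsum f M -> bsum (f \o e) M.
Proof.
move=> einj fM F; have := fM [fset e x | x in F]%fset.
by rewrite big_imfset//= => x y _ _ /einj.
Qed.

(** Superadditivity of [tsum], applied one index at a time, moves the finite sum inside. The bounds
    [m i] ensure that every [tsum] is a genuine sum. *)
Lemma sum_tsum (I T : choiceType) (s : seq I) (f : I -> T -> R) (m : I -> R) M :
  (forall i k, 0 <= f i k) -> (forall i, bsum (f i) (m i)) ->
  bsum (fun k => \sum_(i <- s) f i k) M ->
  \sum_(i <- s) tsum (f i) <= M.
Proof.
move=> f0 fm sM; apply: (@le_trans _ _ (tsum (fun k => \sum_(i <- s) f i k)));
  last exact: tsum_le.
have sb : bsum (fun k => \sum_(i <- s) f i k) (\sum_(i <- s) m i).
  by move=> F; rewrite exchange_big/=; apply: ler_sum => i _; exact: fm.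
elim: s {sM} sb => [|i s IHs] sb; first by rewrite big_nil (tsum_ge0 sb).
rewrite big_cons; have sb' : bsum (fun k => \sum_(i <- s) f i k) (\sum_(i <- s) m i).
  by move=> F; rewrite exchange_big/=; apply: ler_sum => j _; exact: fm.
apply: (@le_trans _ _ (tsum (f i) + tsum (fun k => \sum_(i <- s) f i k))).
  by rewrite lerD2l IHs.
apply: tsumD_le => //; first by move=> k; rewrite sumr_ge0.
by move: (bsum_tsum sb); congr bsum; apply/funext => k; rewrite big_cons.
Qed.

(** Tonelli's theorem for nonnegative double families, in the form of bounds on finite partial
    sums. *)
Lemma bsum_exchange (T1 T2 : choiceType) (f : T2 -> T1 -> R) (m : T2 -> R) M :
  (forall l k, 0 <= f l k) -> (forall l, bsum (f l) (m l)) -> bsum m M ->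
  bsum (fun k => tsum (f^~ k)) M.
Proof.
move=> f0 fm mM F; apply: (sum_tsum (m := fun=> M)) => // [k|G].
  by apply: le_bsum mM => l; exact: bsum_term.
by apply: le_trans (mM G); apply: ler_sum => l _; exact: fm.
Qed.

(** For [q <= 1] a number of the unit interval does not exceed its [q]-th power. This is applied to
    the fractions x / (x + y) and y / (x + y), which add up to 1. *)
Lemma powRD_le (q x y : R) : 0 < q <= 1 -> 0 <= x -> 0 <= y ->
  (x + y) `^ q <= x `^ q + y `^ q.
Proof.
move=> /andP[q0 q1] x0 y0; have [->|] := eqVneq (x + y) 0.
  by rewrite powR0 ?gt_eqF// addr_ge0 ?powR_ge0.
rewrite neq_lt ltNge addr_ge0//= => s0.
have le z : 0 <= z -> z <= x + y -> z / (x + y) <= (z / (x + y)) `^ q.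
  rewrite le_eqVlt => /predU1P[<-|z0] zs; first by rewrite mul0r powR_ge0.
  by apply: ger1_powR => //; rewrite divr_gt0//= ler_pdivrMr ?mul1r.
have p0 : 0 < (x + y) `^ q by exact: powR_gt0.
have -> : x `^ q + y `^ q = (x + y) `^ q * ((x / (x + y)) `^ q + (y / (x + y)) `^ q).
  by rewrite mulrDr -!powRM ?divr_ge0 ?addr_ge0// ![(x + y) * _]mulrC !divfK ?gt_eqF.
rewrite ler_peMr ?powR_ge0//; apply: le_trans (lerD (le _ x0 _) (le _ y0 _)).
- by rewrite -mulrDl divff ?gt_eqF.
- by rewrite lerDl.
- by rewrite lerDr.
Qed.

Lemma powR_sum_le (q : R) (I : Type) (s : seq I) (f : I -> R) : 0 < q <= 1 ->
  (forall i, 0 <= f i) -> (\sum_(i <- s) f i) `^ q <= \sum_(i <- s) f i `^ q.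
Proof.
move=> q01 f0; elim: s => [|i s IHs].
  by rewrite !big_nil powR0// gt_eqF//; case/andP: q01.
by rewrite !big_cons (le_trans (powRD_le _ _ _))// ?sumr_ge0// lerD2l.
Qed.

(** The inclusion of l^q in l^1 with its norm bound: take [q]-th roots in the subadditivity of the
    power. *)
Lemma bsum_powR (q : R) (T : choiceType) (f : T -> R) M : 0 < q <= 1 ->
  (forall k, 0 <= f k) -> bsum (fun k => f k `^ q) M -> bsum f (M `^ q^-1).
Proof.
move=> q01 f0 fM F; have q0 : 0 < q by case/andP: q01.
have s0 : 0 <= \sum_(k <- F) f k by rewrite sumr_ge0.
rewrite -(powRr1 s0) -(divff (lt0r_neq0 q0)) powRrM ge0_ler_powR ?nnegrE ?invr_ge0 ?powR_ge0//.
- exact: ltW.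
- exact: bsum_ge0 fM.
by rewrite (le_trans (powR_sum_le _ _ _)).
Qed.

Lemma tsum_powR_le (q : R) (T : choiceType) (f : T -> R) M : 0 < q <= 1 ->
  (forall k, 0 <= f k) -> bsum (fun k => f k `^ q) M -> tsum f `^ q <= M.
Proof.
move=> q01 f0 fM; have q0 : 0 < q by case/andP: q01.
have fb := bsum_powR q01 f0 fM.
have -> : M = (M `^ q^-1) `^ q by rewrite -powRrM mulVf ?powRr1 ?gt_eqF// (bsum_ge0 fM).
by rewrite ge0_ler_powR ?nnegrE ?powR_ge0 ?(tsum_ge0 fb) ?(tsum_le fb)// ltW.
Qed.

End bounded_sums.

(** * Complex sums *)

Section complex_sums.
Variable R : realType.

Lemma normc_ge0 (x : R[i]) : 0 <= normc x.
Proof. by case: x => x y; exact: sqrtr_ge0. Qed.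

Lemma normc_real (x : R) : normc (x%:C)%C = `|x|.
Proof. by rewrite /normc/= expr0n/= addr0 sqrtr_sqr. Qed.

Lemma norm_normc (x : R[i]) : `|x| = (normc x)%:C%C.
Proof. by rewrite normc_def; case: x. Qed.

Lemma normcB (x y : R[i]) : normc (x - y) = normc (y - x).
Proof. by rewrite -normcN opprB. Qed.

Lemma le_normc_sum (I : Type) (s : seq I) (f : I -> R[i]) :
  normc (\sum_(i <- s) f i) <= \sum_(i <- s) normc (f i).
Proof.
elim: s => [|i s IHs]; first by rewrite !big_nil normc0.
by rewrite !big_cons (le_trans (le_normcD _ _))// lerD2l.
Qed.

Lemma normc_real_le (x : R[i]) : normc (complex.Re x)%:C%C <= normc x /\
  normc (complex.Im x)%:C%C <= normc x.
Proof.
case: x => a b; rewrite !normc_real /= -!sqrtr_sqr.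
by rewrite !ler_wsqrtr// (lerDl, lerDr) sqr_ge0.
Qed.

(** Convergence along the directed set of finite subsets, spelled out with a real [e]; [csumE] links
    it to the filter limit behind [csum]. *)
Definition has_csum (T : choiceType) (f : T -> R[i]) (s : R[i]) : Prop :=
  forall e : R, 0 < e -> exists F : {fset T}, forall G : {fset T},
    (F `<=` G)%fset -> normc (s - \sum_(k <- G) f k) < e.

Section one_index.
Variable T : choiceType.
Implicit Types (f g : T -> R[i]) (F G : {fset T}).

Lemma has_csumD f g s t : has_csum f s -> has_csum g t ->
  has_csum (fun k => f k + g k) (s + t).
Proof.
move=> fs gt e e0; have e2 : 0 < e / 2 by rewrite divr_gt0.
have [F HF] := fs _ e2; have [G HG] := gt _ e2.
exists (F `|` G)%fset => H; rewrite fsubUset => /andP[/HF fH /HG gH].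
rewrite big_split/= opprD addrACA (le_lt_trans (le_normcD _ _))//.
by rewrite [e]splitr ltrD.
Qed.

Lemma has_csumZ c f s : has_csum f s -> has_csum (fun k => c * f k) (c * s).
Proof.
move=> fs e e0; have c0 : 0 < normc c + 1 by rewrite ltr_wpDl// normc_ge0.
have [|F HF] := fs (e / (normc c + 1)); first by rewrite divr_gt0.
exists F => G /HF; rewrite -mulr_sumr -mulrBr normcM ltr_pdivlMr//.
apply: le_lt_trans; rewrite mulrC ler_wpM2l ?normc_ge0// lerDl//.
Qed.

Lemma has_csum_ge0 (f : T -> R) M : (forall k, 0 <= f k) -> bsum f M ->
  has_csum (fun k => (f k)%:C%C) (tsum f)%:C%C.
Proof.
move=> f0 fM e e0; have [F Fe] := tsum_approx fM e0.
exists F => G FG; rewrite -rmorph_sum -rmorphB/= normc_real ger0_norm.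
  rewrite ltrBlDr -ltrBlDl (lt_le_trans Fe)// ler_sum_fsubset//.
by rewrite subr_ge0; exact: (bsum_tsum fM).
Qed.

Lemma has_csum_real (f : T -> R) M : bsum (fun k => `|f k|) M ->
  exists s, has_csum (fun k => (f k)%:C%C) s.
Proof.
move=> fM.
have pM : bsum (fun k => Num.max (f k) 0) M.
  by apply: le_bsum fM => k; rewrite ge_max normr_ge0 ler_norm.
have nM : bsum (fun k => Num.max (- f k) 0) M.
  by apply: le_bsum fM => k; rewrite ge_max normr_ge0 -normrN ler_norm.
have p0 k : 0 <= Num.max (f k) 0 by rewrite le_max lexx orbT.
have n0 k : 0 <= Num.max (- f k) 0 by rewrite le_max lexx orbT.
have := has_csumD (has_csum_ge0 p0 pM) (has_csumZ (-1) (has_csum_ge0 n0 nM)).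
move=> fs; eexists; move: fs; congr has_csum; apply/funext => k.
rewrite mulN1r -rmorphB/=; congr (_%:C)%C.
have [fk0|/ltW fk0] := leP 0 (f k).
  by rewrite [X in _ - X]max_r ?oppr_le0// subr0.
by rewrite max_l ?oppr_ge0// add0r opprK.
Qed.

Lemma has_csum_abs f M : bsum (fun k => normc (f k)) M -> exists s, has_csum f s.
Proof.
move=> fM.
have [|s fs] := @has_csum_real (fun k => complex.Re (f k)) M.
  by apply: le_bsum fM => k; rewrite -normc_real; case: (normc_real_le (f k)).
have [|t ft] := @has_csum_real (fun k => complex.Im (f k)) M.
  by apply: le_bsum fM => k; rewrite -normc_real; case: (normc_real_le (f k)).
exists (s + 'i%C * t); move: (has_csumD fs (has_csumZ 'i%C ft)).
by congr has_csum; apply/funext => k; rewrite -complexE.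
Qed.

Lemma has_csum_norm f s M : has_csum f s -> bsum (fun k => normc (f k)) M ->
  normc s <= M.
Proof.
move=> fs fM; apply/ler_addgt0Pr => e /fs[F /(_ _ (fsubset_refl _)) Fe].
rewrite -[s](subrK (\sum_(k <- F) f k)) (le_trans (le_normcD _ _))// addrC lerD//.
  by rewrite (le_trans (le_normc_sum _ _)).
exact: ltW.
Qed.

End one_index.

Lemma has_csum_bij (T T' : choiceType) (e : T' -> T) (e' : T -> T') f s :
  cancel e e' -> cancel e' e -> has_csum f s -> has_csum (f \o e) s.
Proof.
move=> eK e'K fs x /fs[F HF]; exists [fset e' k | k in F]%fset => G FG.
have := HF [fset e k | k in G]%fset; rewrite big_imfset/=; last first.
  by move=> ? ? _ _ /(can_inj eK).
apply; apply/fsubsetP => k kF; apply/imfsetP; exists (e' k); rewrite ?e'K//.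
by apply: (fsubsetP FG); apply/imfsetP; exists k.
Qed.

Section csum.
Variable d : nat.
Implicit Types f g : 'rV[int]_d -> R[i].

Lemma csumE f s : has_csum f s -> csum (f : cseq R d) = s.
Proof.
move=> fs; rewrite /csum /summability.sum.
have fT := @summability.totally_filter 'rV[int]_d.
apply: cvg_lim; first exact: norm_hausdorff.
(* A positive [e] of [R[i]] has zero imaginary part and positive real part, so the complex condition
   reduces to the real one. *)
apply/cvgrPdist_lt => e; rewrite ltcE => /andP[/eqP eI e0].
have [F HF] := fs _ e0; exists F => //= G /HF.
rewrite /summability.partial_sum -(big_seq_fsetE _ G predT f) /=.
rewrite norm_normc => ?.
by rewrite ltcE /= eI eqxx.
Qed.

Lemma has_csumP f M : bsum (fun k => normc (f k)) M -> has_csum f (csum (f : cseq R d)).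
Proof. by move=> /has_csum_abs[s fs]; rewrite (csumE fs). Qed.

Lemma normc_csum f M : bsum (fun k => normc (f k)) M -> normc (csum (f : cseq R d)) <= M.
Proof. by move=> fM; exact: has_csum_norm (has_csumP fM) fM. Qed.

End csum.

End complex_sums.

(** * Weights on the lattice *)

Section lattice.
Variables (R : realType) (d : nat).
Implicit Types k l : 'rV[int]_d.

(** The l^1 norm on the lattice. Being a natural number it can serve as an exponent, and it is
    equivalent to the Euclidean norm that enters [weight]. *)
Definition onorm k : nat := (\sum_i absz (k ord0 i))%N.

Lemma onorm0 : onorm 0 = 0%N.
Proof. by rewrite /onorm big1// => i _; rewrite mxE. Qed.

Lemma onormN k : onorm (- k) = onorm k.
Proof. by apply: eq_bigr => i _; rewrite mxE abszN. Qed.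

Lemma onormB k l : onorm (k - l) = onorm (l - k).
Proof. by rewrite -onormN opprB. Qed.

Lemma onormD k l : (onorm (k + l) <= onorm k + onorm l)%N.
Proof.
rewrite -big_split/=; apply: leq_sum => i _; rewrite mxE.
by rewrite -lez_nat PoszD !abszE ler_normD.
Qed.

Lemma onormMn k n : (onorm (k *+ n) <= n * onorm k)%N.
Proof.
elim: n => [|n IHn]; first by rewrite mulr0n onorm0.
by rewrite mulrS mulSn (leq_trans (onormD _ _))// leq_add2l.
Qed.

Lemma euclid_le_onorm k : euclid R k <= (onorm k)%:R.
Proof.
rewrite -[leRHS]ger0_norm// -sqrtr_sqr ler_wsqrtr// /onorm natr_sum.
have -> : \sum_i ((k 0 i)%:~R : R) ^+ 2 = \sum_i ((absz (k 0 i))%:R : R) ^+ 2.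
  by apply: eq_bigr => i _; rewrite natr_absz intr_norm real_normK// num_real.
suff [//] : \sum_(i < d) ((absz (k 0 i))%:R : R) ^+ 2 <=
    (\sum_(i < d) (absz (k 0 i))%:R) ^+ 2 /\
  0 <= \sum_(i < d) ((absz (k 0 i))%:R : R).
elim/big_rec2 : _ => [|i x y _ [xy x0]]; first by rewrite expr0n/=.
split; last by rewrite addr_ge0.
by rewrite sqrrD -addrA lerD2l (le_trans xy)// lerDr mulrn_wge0// mulr_ge0.
Qed.

Lemma onorm_le_euclid k : (onorm k)%:R <= d%:R * euclid R k.
Proof.
rewrite /onorm natr_sum mulr_natl -[X in _ *+ X]card_ord -sumr_const.
apply: ler_sum => i _; rewrite natr_absz intr_norm -sqrtr_sqr ler_wsqrtr//.
by rewrite (bigD1 i)//= lerDl sumr_ge0// => j _; rewrite sqr_ge0.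
Qed.

Definition wt (p : R) k : R := (1 + (onorm k)%:R) `^ p.

Lemma wt_ge1 p k : 0 <= p -> 1 <= wt p k.
Proof. by move=> p0; rewrite -(powRr0 (1 + (onorm k)%:R)) ler_powR ?lerDl. Qed.

Lemma wt_gt0 p k : 0 < wt p k.
Proof. by rewrite powR_gt0// ltr_wpDr. Qed.

Lemma wt_ge0 p k : 0 <= wt p k.
Proof. exact/ltW/wt_gt0. Qed.

Lemma wt0 p : wt p 0 = 1.
Proof. by rewrite /wt onorm0 addr0 powR1. Qed.

(** Raise 1 + |k + l| <= (1 + |k|) (1 + |l|) to the power [p]. *)
Lemma wtD p k l : 0 <= p -> wt p (k + l) <= wt p k * wt p l.
Proof.
move=> p0; rewrite -powRM ?addr_ge0// ge0_ler_powR ?nnegrE ?mulr_ge0 ?addr_ge0//.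
have : (onorm (k + l))%:R <= (onorm k)%:R + (onorm l)%:R :> R.
  by rewrite -natrD ler_nat onormD.
have : 0 <= (onorm k)%:R * (onorm l)%:R :> R by rewrite mulr_ge0.
move: (_%:R) (_%:R) (_%:R) => x y z; lra.
Qed.

End lattice.

(** * Membership in the weighted spaces through finite sums *)

Section weighted_sequences.
Variable R : realType.

Lemma bsum_esum (T : choiceType) (f : T -> R) M :
  bsum f M <-> (\esum_(k in [set: T]) (f k)%:E <= M%:E)%E.
Proof.
split=> [fM|fM F].
  apply: ge_ereal_sup => _ [X [finX _] <-]; rewrite fsbig_finite//= sumEFin lee_fin.
  exact: fM.
rewrite -lee_fin -sumEFin (le_trans _ fM)//; apply: ereal_sup_ubound => /=.
exists [set` F]; first by split => //; exact: finite_fset.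
by rewrite fsbig_finite ?finite_fset//= set_fsetK.
Qed.

Lemma bsum_esumP (T : choiceType) (f : T -> R) : (forall k, 0 <= f k) ->
  (exists M, bsum f M) <-> (\esum_(k in [set: T]) (f k)%:E < +oo)%E.
Proof.
move=> f0; split=> [[M /bsum_esum fM]|foo]; first by rewrite (le_lt_trans fM)// ltry.
exists (fine (\esum_(k in [set: T]) (f k)%:E)); apply/bsum_esum; rewrite fineK//.
by rewrite ge0_fin_numE// esum_ge0// => k _; rewrite lee_fin.
Qed.

Variable d : nat.
Implicit Types (a : cseq R d) (k : 'rV[int]_d).

(** The Euclidean weight may be replaced by [wt]: the Euclidean norm is at most [onorm], which is at
    most [d] times the Euclidean norm. One direction costs a factor (d + 1)^(s q). *)
Lemma ell_bsum (q s : R) a : 0 < q -> 0 <= s ->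
  ell d q s a <-> exists M, bsum (fun k => normc (a k) `^ q * wt (s * q) k) M.
Proof.
move=> q0 s0; have p0 : 0 <= s * q by rewrite mulr_ge0// ltW.
have e0 k : 0 <= 1 + euclid R k by rewrite addr_ge0// sqrtr_ge0.
rewrite (ellE s q0); rewrite -bsum_esumP; last first.
  by move=> k; rewrite mulr_ge0 ?powR_ge0.
split=> -[M aM].
  exists ((d.+1%:R) `^ (s * q) * M).
  apply: le_bsum (bsumZ _ aM) => [k|]; last exact: powR_ge0.
  rewrite mulrCA ler_wpM2l ?powR_ge0// /weight -powRrM -powRM//.
  rewrite ge0_ler_powR ?nnegrE ?p0 ?mulr_ge0 ?e0 ?addr_ge0//.
  rewrite mulrDr mulr1 lerD ?ler1n//; apply: (le_trans (onorm_le_euclid R k)).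
  by rewrite ler_wpM2r ?sqrtr_ge0// ler_nat.
exists M; apply: le_bsum aM => k; rewrite ler_wpM2l ?powR_ge0// /weight -powRrM.
by rewrite ge0_ler_powR ?nnegrE ?p0 ?e0 ?addr_ge0// lerD2l euclid_le_onorm.
Qed.

Lemma ellnorm2_le a (M : R) : 0 <= M ->
  (ellnorm 2 0 a <= M%:E)%E <-> bsum (fun k => normc (a k) ^+ 2) (M ^+ 2).
Proof.
move=> M0; rewrite bsum_esum /ellnorm.
have -> : (\esum_(k in [set: 'rV[int]_d]) (normc (a k) `^ 2 * weight 0 k `^ 2)%:E =
    \esum_(k in [set: 'rV[int]_d]) (normc (a k) ^+ 2)%:E)%E.
  apply: eq_esum => k _; rewrite /weight powRr0 powR1 mulr1 powR_mulrn//.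
  exact: normc_ge0.
set x := esum _ _; have x0 : (0 <= x)%E.
  by apply: esum_ge0 => k _; rewrite lee_fin sqr_ge0.
have half : (0 <= 2^-1 :> R) by rewrite invr_ge0.
have in0 (y : \bar R) : (0 <= y)%E -> y \in `[0%E, +oo%E].
  by move=> y0; rewrite in_itv/= y0 leey.
have two : (0 <= 2 :> R) by [].
have M2 : M ^+ 2 = M `^ 2 by rewrite powR_mulrn.
split=> xM.
  have := gt0_ler_poweR two (in0 _ (poweR_ge0 _ _)) (in0 M%:E _) xM.
  rewrite -poweRrM mulVf// poweRe1// poweR_EFin -M2; apply; by rewrite lee_fin.
have := gt0_ler_poweR half (in0 _ x0) (in0 (M ^+ 2)%:E _) xM.
rewrite poweR_EFin M2 -powRrM divff// powRr1//; apply.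
by rewrite lee_fin powR_ge0.
Qed.

End weighted_sequences.

(** * Exponential sequences, and the weighted l^q quasi-norm as an algebra quasi-norm *)

Section weighted_estimates.
Variables (R : realType) (d : nat).
Implicit Types k l : 'rV[int]_d.

Lemma geometric_sum_le (t : R) n : 0 <= t < 1 -> \sum_(i < n) t ^+ i <= (1 - t)^-1.
Proof.
move=> /andP[t0 t1]; have t1' : 0 < 1 - t by rewrite subr_gt0.
rewrite -[_^-1]mul1r ler_pdivlMr// mulrC -opprB mulNr -subrX1 opprB.
by rewrite gerBl exprn_ge0.
Qed.

Lemma div_pow2_small (C t : R) : 0 <= C -> 0 < t -> exists m, C / 2 ^+ m <= t.
Proof.
move=> C0 t0; exists (Num.bound (C / t)).
rewrite ler_pdivrMr ?exprn_gt0// mulrC -ler_pdivrMr//.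
apply: le_trans (ltW (archi_boundP _)) _; first by rewrite divr_ge0 ?(ltW t0).
by rewrite -natrX ler_nat ltnW// ltn_expl.
Qed.

(** The series factors over the coordinates into [d] series over the integers, each at most 2 / (1 -
    t) because an absolute value comes with at most two signs. *)
Lemma bsum_geometric (t : R) : 0 <= t < 1 ->
  exists M, bsum (fun k => t ^+ onorm k) M.
Proof.
move=> t01; have /andP[t0 t1] := t01.
exists (((1 - t)^-1 *+ 2) ^+ d) => F.
pose n := (\sum_(k <- F) onorm k)%N.
pose phi (jb : 'I_n.+1 * bool) : R := t ^+ jb.1.
(* Each coordinate is recorded by its absolute value and its sign bit. The code is injective on [F],
   so the sum over [F] is at most a sum over all functions. *)
pose code (k : 'rV[int]_d) : {ffun 'I_d -> 'I_n.+1 * bool} :=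
  [ffun i => (inord (absz (k ord0 i)), k ord0 i < 0)].
have small k i : k \in F -> (absz (k ord0 i) < n.+1)%N.
  move=> kF; rewrite ltnS /n (big_fsetD1 k)//=.
  by rewrite /onorm (bigD1 i)//= -addnA leq_addr.
have code_inj : {in F &, injective code}.
  move=> k l kF lF /ffunP kl; apply/rowP => i; have := kl i; rewrite !ffunE => -[].
  move=> /(congr1 val); rewrite /= !inordK ?small// => kl0 kl1.
  by rewrite [LHS]intEsign [RHS]intEsign kl0 kl1.
have -> : \sum_(k <- F) t ^+ onorm k = \sum_(x <- map code F) \prod_i phi (x i).
  rewrite big_map big_seq [RHS]big_seq; apply: eq_bigr => k kF.
  rewrite /onorm -prodrXr; apply: eq_bigr => i _.
  by rewrite /phi ffunE /= inordK ?small.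
rewrite big_uniq ?map_inj_in_uniq ?fset_uniq//=.
apply: (@le_trans _ _ (\sum_(x : {ffun 'I_d -> 'I_n.+1 * bool}) \prod_i phi (x i))).
  rewrite [leRHS](bigID (mem (map code F)))/= lerDl sumr_ge0// => x _.
  by rewrite prodr_ge0// => i _; rewrite /phi exprn_ge0.
(* Distributivity turns the sum over functions into the [d]-th power of a one-coordinate sum. *)
rewrite -(bigA_distr_bigA (fun _ => phi)) prodr_const card_ord.
have phi0 : 0 <= \sum_j phi j by rewrite sumr_ge0// => j _; rewrite /phi exprn_ge0.
rewrite lerXn2r ?nnegrE ?mulrn_wge0 ?invr_ge0 ?subr_ge0 ?(ltW t1)//.
rewrite -(pair_bigA _ (fun j b => phi (j, b)))/= exchange_big big_bool/= /phi/= mulr2n.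
by rewrite lerD// geometric_sum_le.
Qed.

Lemma powR_exprn (x q : R) n : 0 <= x -> (x `^ q) ^+ n = (x ^+ n) `^ q.
Proof. by move=> x0; rewrite -[LHS]powR_mulrn ?powR_ge0// powRAC powR_mulrn. Qed.

(** For [p > 0] and u = t^(1/p) the quantity is the [p]-th power of (1 + n) u^n, and this is at most
    1 + u + ... + u^n since each of these terms is at least u^n. *)
Lemma poly_geometric_bound (p t : R) : 0 <= p -> 0 < t < 1 ->
  exists C, forall n : nat, (1 + n%:R) `^ p * t ^+ n <= C.
Proof.
move=> p0 /andP[t0 t1]; have [->|pn0] := eqVneq p 0.
  by exists 1 => n; rewrite powRr0 mul1r exprn_ile1 // ltW.
pose u := t `^ p^-1; have u0 : 0 < u by exact: powR_gt0.
have pp : 0 < p by rewrite lt_def pn0.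
have tu : t = u `^ p by rewrite -powRrM mulVf// powRr1// ltW.
have u1 : u < 1.
  have -> : (1 : R) = 1 `^ p^-1 by rewrite powR1.
  apply: gt0_ltr_powR; rewrite ?invr_gt0 ?nnegrE//.
  exact: ltW.
exists ((1 - u)^-1 `^ p) => n.
have -> : t ^+ n = (u ^+ n) `^ p.
  by rewrite tu powR_exprn// ltW.
have un0 : 0 <= u ^+ n by rewrite exprn_ge0// ltW.
rewrite -powRM ?addr_ge0// ge0_ler_powR ?nnegrE ?mulr_ge0 ?addr_ge0 ?invr_ge0
  ?subr_ge0 ?(ltW u1)//.
apply: le_trans (@geometric_sum_le u n.+1 _); last by rewrite (ltW u0).
rewrite -[1 + _]/(1%:R + _) -natrD add1n mulr_natl -[X in _ *+ X]card_ord -sumr_const.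
apply: ler_sum => i _; apply: ler_wiXn2l; [exact: ltW|exact: ltW|].
by rewrite -ltnS.
Qed.

(** Write t = u u: one factor u^|k| absorbs the polynomial weight, the other is summable. *)
Lemma bsum_geometric_wt (p t : R) : 0 <= p -> 0 < t < 1 ->
  exists M, bsum (fun k => t ^+ onorm k * wt p k) M.
Proof.
move=> p0 /andP[t0 t1]; pose u := Num.sqrt t.
have u0 : 0 < u by rewrite sqrtr_gt0.
have u1 : u < 1 by rewrite -sqrtr1 ltr_sqrt.
have [C HC] : exists C, forall n : nat, (1 + n%:R) `^ p * u ^+ n <= C.
  by apply: poly_geometric_bound => //; rewrite u0.
have [M HM] : exists M, bsum (fun k => u ^+ onorm k) M.
  by apply: bsum_geometric; rewrite ltW.
have C0 : 0 <= C.
  by apply: le_trans (HC 0%N); rewrite mulr_ge0 ?powR_ge0// exprn_ge0// ltW.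
exists (C * M); apply: le_bsum (bsumZ C0 HM) => k.
rewrite -[t]sqr_sqrtr ?(ltW t0)// -/u exprAC expr2 -mulrA mulrC.
rewrite ler_wpM2r ?exprn_ge0 ?(ltW u0)//.
by rewrite mulrC HC.
Qed.

Variable (q p : R).
Hypotheses (q01 : 0 < q <= 1) (p0 : 0 <= p).
Implicit Types a x : 'rV[int]_d -> R.

Let q0 : 0 < q. Proof. by case/andP: q01. Qed.

(** For p = s q this bounds the [q]-th power of the quasi-norm of the weighted space, up to
    equivalence of weights. The [q]-th power is used because it is subadditive. *)
Definition wsum a M := bsum (fun k => a k `^ q * wt p k) M.

Lemma wsum_powR a M : wsum a M -> bsum (fun k => a k `^ q) M.
Proof. by apply: le_bsum => k; rewrite ler_peMr ?powR_ge0 ?wt_ge1. Qed.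

Lemma wsum_bsum a M : (forall k, 0 <= a k) -> wsum a M -> bsum a (M `^ q^-1).
Proof. by move=> a0 /wsum_powR; exact: bsum_powR. Qed.

Lemma wsum_sup a M k : (forall k, 0 <= a k) -> wsum a M -> a k <= M `^ q^-1.
Proof. by move=> a0 /(wsum_bsum a0)/bsum_term. Qed.

Lemma le_wsum a x M : (forall k, 0 <= a k <= x k) -> wsum x M -> wsum a M.
Proof.
move=> ax; apply: le_bsum => k; have /andP[a0 akx] := ax k.
rewrite ler_wpM2r ?wt_ge0// ge0_ler_powR ?nnegrE//; first exact: ltW.
exact: le_trans akx.
Qed.

Lemma wsumD a x M N : (forall k, 0 <= a k) -> (forall k, 0 <= x k) ->
  wsum a M -> wsum x N -> wsum (fun k => a k + x k) (M + N).
Proof.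
move=> a0 x0 aM xN; apply: le_bsum (bsumD aM xN) => k.
by rewrite -mulrDl ler_wpM2r ?wt_ge0// powRD_le.
Qed.

Lemma wsumZ c a M : 0 <= c -> (forall k, 0 <= a k) ->
  wsum a M -> wsum (fun k => c * a k) (c `^ q * M).
Proof.
move=> c0 a0 aM; apply: le_bsum (bsumZ (powR_ge0 _ _) aM) => k.
by rewrite powRM// mulrA.
Qed.

Lemma bsum_conv a x A X n : (forall k, 0 <= a k) -> (forall k, 0 <= x k) ->
  bsum a A -> (forall k, x k <= X) -> bsum (fun m => a m * x (n - m)) (A * X).
Proof.
move=> a0 x0 aA xX; rewrite mulrC.
have X0 : 0 <= X by exact: le_trans (xX 0).
by apply: le_bsum (bsumZ X0 aA) => k; rewrite [X * _]mulrC ler_wpM2l.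
Qed.

(** The algebra property: the [q]-th power of a sum is at most the sum of the [q]-th powers, the
    weight is submultiplicative, and Tonelli's theorem sums the result over [n]. *)
Lemma wsum_conv a x A X : (forall k, 0 <= a k) -> (forall k, 0 <= x k) ->
  wsum a A -> wsum x X ->
  wsum (fun n => tsum (fun m => a m * x (n - m))) (A * X).
Proof.
move=> a0 x0 aA xX.
pose f m n := (a m `^ q * wt p m) * (x (n - m) `^ q * wt p (n - m)).
have f0 m n : 0 <= f m n by rewrite !mulr_ge0 ?powR_ge0.
have fm m : bsum (f m) (X * (a m `^ q * wt p m)).
  rewrite mulrC; apply: bsumZ; first by rewrite mulr_ge0 ?powR_ge0.
  by apply: (bsum_inj (e := fun n => n - m) _ xX) => k l /addIr.
have mM : bsum (fun m => X * (a m `^ q * wt p m)) (A * X).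
  by rewrite mulrC; apply: bsumZ => //; exact: bsum_ge0 xX.
apply: le_bsum (bsum_exchange f0 fm mM) => n.
have fn : bsum (f^~ n) (A * X) by apply: le_bsum mM => m; exact: bsum_term (fm m).
rewrite -ler_pdivlMr ?wt_gt0//; apply: tsum_powR_le => // [m|]; first by rewrite mulr_ge0.
have wi0 : 0 <= (wt p n)^-1 by rewrite invr_ge0 wt_ge0.
rewrite mulrC; apply: le_bsum (bsumZ wi0 (bsum_tsum fn)) => m.
rewrite [leRHS]mulrC ler_pdivlMr ?wt_gt0// /f mulrACA -powRM// ler_wpM2l ?powR_ge0//.
by rewrite -{1}[n](subrK m) addrC wtD.
Qed.

(** A finite set [F] carries all but e / 2 of the sum. Outside it the factor is at most 1; on it the
    factor is small once [r] is close to 1. *)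
Lemma wsum_shrink a M e : (forall k, 0 <= a k) -> wsum a M -> 0 < e ->
  exists2 r, 0 < r < 1 & wsum (fun k => a k * (1 - r ^+ onorm k)) e.
Proof.
move=> a0 aM e0; have e2 : 0 < e / 2 by rewrite divr_gt0.
have t0 k : 0 <= a k `^ q * wt p k by rewrite mulr_ge0 ?powR_ge0.
have [F HF] := bsum_tail t0 aM e2.
have M0 := bsum_ge0 aM.
have M1 : 0 < M + 1 by rewrite ltr_wpDl.
pose n := (\sum_(k <- F) onorm k).+1.
(* The second entry makes (h n)^q M at most e / 2, where [n] exceeds [onorm k] for every [k] in [F];
   the first keeps [1 - h] positive. *)
pose h := Num.min (2^-1) ((e / 2 / (M + 1)) `^ q^-1 / n%:R).
have h0 : 0 < h by rewrite lt_min invr_gt0 ltr0n/= divr_gt0 ?powR_gt0 ?divr_gt0 ?ltr0n.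
have h1 : h < 1 by rewrite gt_min invf_lt1// ltr1n.
have hn : (h * n%:R) `^ q * M <= e / 2.
  have hle : h * n%:R <= (e / 2 / (M + 1)) `^ q^-1.
    by rewrite -ler_pdivlMr ?ltr0n// ge_min lexx orbT.
  apply: (@le_trans _ _ (e / 2 / (M + 1) * M)).
    rewrite ler_wpM2r//; have -> : e / 2 / (M + 1) = ((e / 2 / (M + 1)) `^ q^-1) `^ q.
      by rewrite -powRrM mulVf ?gt_eqF// powRr1// ltW// divr_gt0.
    by rewrite ge0_ler_powR ?nnegrE ?powR_ge0 ?mulr_ge0 ?(ltW q0) ?(ltW h0).
  by rewrite mulrAC ler_pdivrMr// ler_wpM2l ?(ltW e2)// lerDl.
have r0 : 0 < 1 - h by rewrite subr_gt0.
have r1 : 1 - h < 1 by rewrite gtrBl.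
exists (1 - h); first by rewrite r0.
have c01 k : 0 <= 1 - (1 - h) ^+ onorm k <= 1.
  by rewrite subr_ge0 exprn_ile1 ?(ltW r0) ?(ltW r1)//= gerBl exprn_ge0// ltW.
have hM : bsum (fun k => (h * n%:R) `^ q * (a k `^ q * wt p k)) (e / 2).
  by apply: bsum_le hn _; apply: bsumZ aM; exact: powR_ge0.
rewrite [e]splitr; apply: le_bsum (bsumD hM HF) => k.
rewrite powRM//; last by case/andP: (c01 k).
rewrite mulrAC mulrC; case: ifPn => [kF|_]; last first.
  rewrite ler_wpDl ?mulr_ge0 ?powR_ge0// ler_piMl//.
  have /andP[? ?] := c01 k.
  have p1 : 1 `^ q = 1 :> R by rewrite powR1.
  rewrite -[X in _ <= X]p1.
  by rewrite ge0_ler_powR ?nnegrE ?(ltW q0).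
rewrite addr0 ler_wpM2r// ge0_ler_powR ?nnegrE ?(ltW q0) ?mulr_ge0 ?(ltW h0)//.
  by case/andP: (c01 k).
have kn : (onorm k <= n)%N.
  by rewrite /n leqW// (big_fsetD1 k)//= leq_addr.
apply: (@le_trans _ _ (h * (onorm k)%:R)); last by rewrite ler_wpM2l ?(ltW h0)// ler_nat.
(* Bernoulli's inequality (1 - h)^m >= 1 - h m, by induction on [m]. *)
rewrite lerBlDr -lerBlDl; elim: (onorm k) => [|m IHm]; first by rewrite mulr0 subr0 expr0.
rewrite exprS; apply: le_trans (ler_wpM2l (ltW r0) IHm).
have : 0 <= h * (h * m%:R) by rewrite !mulr_ge0 ?(ltW h0).
rewrite -natr1; move: (m%:R : R) => y; nra.
Qed.

(** Bounds survive uniform approximation: for a fixed finite [F] the error [t] adds at most t^q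
    times the total weight of [F], which is arbitrarily small. *)
Lemma wsum_approx a M : (forall k, 0 <= a k) ->
  (forall t, 0 < t -> exists2 b, (forall k, 0 <= b k) /\ wsum b M &
    forall k, a k <= b k + t) -> wsum a M.
Proof.
move=> a0 ab F; pose w := \sum_(n <- F) wt p n.
have w0 : 0 <= w by apply: sumr_ge0 => n _; exact: wt_ge0.
apply/ler_addgt0Pr => e e0; pose t := (e / (w + 1)) `^ q^-1.
have w1 : 0 < w + 1 by rewrite ltr_wpDl.
have t0 : 0 < t by rewrite powR_gt0// divr_gt0.
have [b [b0 bM] abt] := ab _ t0.
have te : t `^ q * w <= e.
  rewrite -powRrM mulVf ?gt_eqF// powRr1 ?divr_ge0 ?(ltW e0) ?(ltW w1)//.
  by rewrite mulrAC ler_pdivrMr// ler_wpM2l ?(ltW e0)// lerDl.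
apply: le_trans (lerD (bM F) te); rewrite /w mulr_sumr -big_split/=.
apply: ler_sum => n _; rewrite -mulrDl ler_wpM2r ?wt_ge0//.
apply: le_trans (powRD_le q01 (b0 n) (ltW t0)).
by rewrite ge0_ler_powR ?nnegrE ?addr_ge0 ?(ltW q0) ?(ltW t0).
Qed.

End weighted_estimates.

(** * Minkowski's inequality for series *)

Section l2_minkowski.
Variable R : realType.

Lemma mul_tsum_le (T : choiceType) (f : T -> R) y m M : 0 <= y -> bsum f m ->
  bsum (fun k => y * f k) M -> y * tsum f <= M.
Proof.
rewrite le_eqVlt => /predU1P[<-|y0] fm yM; first by rewrite mul0r (bsum_ge0 yM).
rewrite mulrC -ler_pdivlMr//; apply: tsum_le => F.
by rewrite ler_pdivlMr// mulrC mulr_sumr.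
Qed.

(** The weighted inequality of arithmetic and geometric means, with the bounds enlarged by [e] so
    that the divisions make sense when [A] or [B] is 0; then [e] tends to 0. *)
Lemma cauchy_schwarz (I : Type) (s : seq I) (f g : I -> R) (A B : R) :
  0 <= A -> 0 <= B -> \sum_(i <- s) f i ^+ 2 <= A ^+ 2 ->
  \sum_(i <- s) g i ^+ 2 <= B ^+ 2 -> \sum_(i <- s) f i * g i <= A * B.
Proof.
move=> A0 B0 fA gB.
have pos e : 0 < e -> \sum_(i <- s) f i * g i <= (A + e) * (B + e).
  move=> e0; have a0 : 0 < A + e by rewrite ltr_wpDl.
  have b0 : 0 < B + e by rewrite ltr_wpDl.
  apply: (@le_trans _ _ (\sum_(i <- s) ((B + e) / (A + e) / 2 * f i ^+ 2 +
      (A + e) / (B + e) / 2 * g i ^+ 2))).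
    apply: ler_sum => i _; rewrite -subr_ge0.
    rewrite (_ : _ - _ = ((B + e) * f i - (A + e) * g i) ^+ 2 / (2 * (A + e) * (B + e))).
      by rewrite divr_ge0 ?sqr_ge0 ?mulr_ge0 ?(ltW a0) ?(ltW b0).
    by field; rewrite !gt_eqF.
  rewrite big_split/= -!mulr_sumr.
  have {}fA : \sum_(i <- s) f i ^+ 2 <= (A + e) ^+ 2.
    by rewrite (le_trans fA)// lerXn2r ?nnegrE ?(ltW a0)// lerDl ltW.
  have {}gB : \sum_(i <- s) g i ^+ 2 <= (B + e) ^+ 2.
    by rewrite (le_trans gB)// lerXn2r ?nnegrE ?(ltW b0)// lerDl ltW.
  have c0 : 0 <= (B + e) / (A + e) / 2 by rewrite !divr_ge0 ?ltW.
  have d0 : 0 <= (A + e) / (B + e) / 2 by rewrite !divr_ge0 ?ltW.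
  apply: le_trans (lerD (ler_wpM2l c0 fA) (ler_wpM2l d0 gB)) _.
  rewrite le_eqVlt; apply/orP; left; apply/eqP; field.
  by rewrite !gt_eqF.
(* For [h <= 1] the product (A + h) (B + h) exceeds A B by at most h (A + B + 1), hence this
   choice. *)
apply/ler_addgt0Pr => e e0; pose h := Num.min 1 (e / (A + B + 1)).
have ab : 0 < A + B + 1 by rewrite ltr_wpDl ?addr_ge0.
have h0 : 0 < h by rewrite lt_min ltr01 divr_gt0.
apply: le_trans (pos _ h0) _.
have h1 : h <= 1 by rewrite ge_min lexx.
have : h * (A + B + 1) <= e by rewrite -ler_pdivlMr// ge_min lexx orbT.
nra.
Qed.

Lemma bsum_sqrD (T : choiceType) (f g : T -> R) A B : 0 <= A -> 0 <= B ->
  bsum (fun k => f k ^+ 2) (A ^+ 2) -> bsum (fun k => g k ^+ 2) (B ^+ 2) ->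
  bsum (fun k => (f k + g k) ^+ 2) ((A + B) ^+ 2).
Proof.
move=> A0 B0 fA gB F; under eq_bigr do rewrite sqrrD.
rewrite !big_split/= sqrrD mulr2n lerD// lerD//.
by rewrite lerD// (cauchy_schwarz A0 B0 (fA F) (gB F)).
Qed.

(** A duality argument: let X be a finite sum of the squares of [y] and x its square root.
    Multiplying the pointwise bound by [y i], summing over [i], exchanging the sums and applying
    Cauchy-Schwarz to each term gives X <= x (A + M); then divide by x. *)
Lemma l2_minkowski (I L : choiceType) (y a : I -> R) (h : L -> I -> R)
    (c t : L -> R) A M : (forall i, 0 <= y i) ->
  (forall l, 0 <= c l) -> (forall l i, 0 <= h l i) -> (forall l, 0 <= t l) ->
  (forall i, y i <= a i + tsum (fun l => c l * h l i)) ->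
  0 <= A -> bsum (fun i => a i ^+ 2) (A ^+ 2) ->
  (forall l, bsum (fun i => h l i ^+ 2) (t l ^+ 2)) ->
  bsum (fun l => c l * t l) M ->
  bsum (fun i => y i ^+ 2) ((A + M) ^+ 2).
Proof.
move=> y0 c0 h0 t0 yle A0 aA ht ctM G.
have M0 : 0 <= M by exact: bsum_ge0 ctM.
have chM i : bsum (fun l => c l * h l i) M.
  apply: le_bsum ctM => l; rewrite ler_wpM2l// -[leLHS]ger0_norm// -[leRHS]ger0_norm//.
  by rewrite -ler_sqr ?nnegrE// !real_normK ?num_real// (bsum_term _ (ht l)).
set X := \sum_(i <- G) y i ^+ 2; have X0 : 0 <= X.
  by rewrite sumr_ge0// => i _; rewrite sqr_ge0.
pose x := Num.sqrt X; have x0 : 0 <= x by exact: sqrtr_ge0.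
have yx : \sum_(i <- G) y i ^+ 2 <= x ^+ 2 by rewrite sqr_sqrtr.
suff : X <= x * (A + M).
  rewrite -[X]sqr_sqrtr// -/x expr2; have [->|xn0] := eqVneq x 0.
    by rewrite !mul0r sqr_ge0.
  have xp : 0 < x by rewrite lt_def xn0.
  by rewrite ler_pM2l// => xAM; rewrite expr2 ler_pM.
have step1 : X <= \sum_(i <- G) y i * a i + \sum_(i <- G) tsum (fun l => y i * (c l * h l i)).
  rewrite -big_split/=; apply: ler_sum => i _; rewrite expr2.
  apply: le_trans (ler_wpM2l (y0 i) (yle i)) _; rewrite mulrDr lerD2l.
  apply: mul_tsum_le (chM i) _ => //; apply: bsum_tsum; exact: bsumZ (chM i).
apply: le_trans step1 _; rewrite mulrDr lerD//; first exact: cauchy_schwarz (aA G).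
apply: (sum_tsum (m := fun i => y i * M)) => [i l|i|].
- by rewrite !mulr_ge0.
- exact: bsumZ.
apply: le_bsum (bsumZ x0 ctM) => l.
under eq_bigr do rewrite mulrCA.
rewrite -mulr_sumr mulrCA ler_wpM2l//; exact: cauchy_schwarz (ht l G).
Qed.

End l2_minkowski.

Section ellspace_elements.
Variables (R : realType) (d : nat) (q : {posnum R}) (s : R).
Implicit Types (a b : ellspace d q s) (k : 'rV[int]_d).

Lemma ellvalD a b k : (a + b) k = a k + b k.
Proof. by []. Qed.

Lemma ellvalN a k : (- a) k = - a k.
Proof. by []. Qed.

End ellspace_elements.

(** * Localization of the inverse *)

Section ell2_operators.
Variables (R : realType) (d : nat).
Implicit Types (k p : 'rV[int]_d).

Definition l2_le (f : 'rV[int]_d -> R[i]) (A : R) : Prop :=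
  bsum (fun k => normc (f k) ^+ 2) (A ^+ 2).

Lemma l2_le_sup f A k : 0 <= A -> l2_le f A -> normc (f k) <= A.
Proof.
move=> A0 /bsum_term fA; have := fA k.
by rewrite ler_sqr ?nnegrE ?normc_ge0.
Qed.

Lemma ell2P (x : ell2 R d) : exists2 A, 0 <= A & l2_le x A.
Proof.
have := ellvalP x; rewrite inE /ell /= => xoo.
have x0 : (0 <= ellnorm 2 0 x)%E by exact: poweR_ge0.
exists (fine (ellnorm 2 0 x)); first exact: fine_ge0.
by apply/ellnorm2_le; rewrite ?fine_ge0// fineK// ge0_fin_numE.
Qed.

Lemma ell2_mk (f : cseq R d) A : 0 <= A -> l2_le f A -> exists x : ell2 R d, x = f :> cseq R d.
Proof.
move=> A0 /(ellnorm2_le _ A0) fA.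
have fP : f \in ellpred (d := d) (pos2 R) 0.
  by rewrite inE /ell /=; exact: le_lt_trans fA (ltry _).
by exists (EllSpace fP).
Qed.

Lemma bounded_opsP (S : ell2 R d -> ell2 R d) : bounded_ops R d S ->
  exists2 C, 0 < C & forall (x : ell2 R d) A, 0 <= A -> l2_le x A -> l2_le (S x) (C * A).
Proof.
(* Passing from [M] to |M| + 1 makes the constant strictly positive. *)
move=> [_ [M SM]]; exists (`|M| + 1); first by rewrite ltr_wpDl.
move=> x A A0 /(ellnorm2_le _ A0) xA; have C0 : 0 <= `|M| + 1 by rewrite addr_ge0.
apply/ellnorm2_le; first by rewrite mulr_ge0.
apply: le_trans (SM x) _; rewrite EFinM.
apply: (@le_trans _ _ ((`|M| + 1)%:E * ellnorm 2 0 x)%E).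
  by rewrite lee_wpmul2r ?poweR_ge0// lee_fin (le_trans (ler_norm _))// lerDl.
by rewrite lee_wpmul2l// lee_fin.
Qed.

Definition kdelta (j k : 'rV[int]_d) : R[i] := (k == j)%:R.

Lemma normc_kdelta j k : normc (kdelta j k) = (k == j)%:R.
Proof. by rewrite /kdelta; case: eqP => _; rewrite ?normc1 ?normc0. Qed.

Lemma bsum_kdelta (f : 'rV[int]_d -> R) j : 0 <= f j ->
  (forall k, k != j -> f k = 0) -> bsum f (f j).
Proof.
move=> f0 fk F; have [jF|jF] := boolP (j \in F).
  by rewrite (big_fsetD1 j)//= big1_seq ?addr0// => k; rewrite !inE => /andP[_ /andP[/fk]].
by rewrite big1_seq// => k kF; apply: fk; apply: contraTneq kF => ->.
Qed.

Lemma l2_le_kdelta j : l2_le (kdelta j) 1.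
Proof.
have := @bsum_kdelta (fun k => normc (kdelta j k) ^+ 2) j; rewrite normc_kdelta eqxx.
apply; first exact: sqr_ge0.
by move=> k /negPf kj; rewrite normc_kdelta kj expr0n.
Qed.

Lemma unit_vector_exists j : exists x : ell2 R d, x = kdelta j :> cseq R d.
Proof. exact: ell2_mk ler01 (l2_le_kdelta j). Qed.

Definition unit_vector j : ell2 R d := projT1 (cid (unit_vector_exists j)).

Lemma unit_vectorE j : unit_vector j = kdelta j :> cseq R d.
Proof. exact: projT2 (cid (unit_vector_exists j)). Qed.

End ell2_operators.

(** * The commutator estimate with exponential bumps *)

Section localization.
Variables (R : realType) (d : nat).
Variables (A : 'rV[int]_d -> 'rV[int]_d -> R[i]) (D : 'rV[int]_d -> R) (E : R).
Hypotheses (D0 : forall k, 0 <= D k) (DE : bsum D E).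
Hypothesis AD : forall i j, normc (A i j) <= D (i - j).

Lemma bsum_row (x : 'rV[int]_d -> R[i]) X i : (forall k, normc (x k) <= X) ->
  bsum (fun j => normc (A i j * x j)) (E * X).
Proof.
move=> xX; have x0 k : 0 <= normc (x k) by exact: normc_ge0.
have := bsum_conv i D0 x0 DE xX.
move=> /(bsum_inj (e := fun j => i - j)) iM.
apply: le_bsum (iM _) => [j|k l /addrI/oppr_inj//].
by rewrite /= normcM subKr ler_wpM2r ?normc_ge0.
Qed.

Variable r : R.
Hypothesis r01 : 0 < r < 1.

Definition spike (p k : 'rV[int]_d) : R := r ^+ onorm (k - p).

Let r0 : 0 < r. Proof. by case/andP: r01. Qed.
Let r1 : r < 1. Proof. by case/andP: r01. Qed.

Lemma spike_ge0 p k : 0 <= spike p k.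
Proof. by rewrite exprn_ge0// ltW. Qed.

Lemma spike_le1 p k : spike p k <= 1.
Proof. by rewrite exprn_ile1// ltW. Qed.

Lemma spike_id p : spike p p = 1.
Proof. by rewrite /spike subrr onorm0. Qed.

Let shrink01 (l : 'rV[int]_d) : 0 <= 1 - r ^+ onorm l.
Proof. by rewrite subr_ge0 exprn_ile1// ltW. Qed.

(** A shift by [l] changes the bump by a factor between r^|l| and its inverse, so the difference is
    at most 1 - r^|l| times the larger value. The value at [i] is written as [spike (p - l) (i - l)]
    so that the last factor is a function of [i] translated by [l]. *)
Lemma spike_diff (p i l : 'rV[int]_d) :
  `|spike p (i - l) - spike p i| <=
  (1 - r ^+ onorm l) * (spike p (i - l) + spike (p - l) (i - l)).
Proof.
have -> : spike (p - l) (i - l) = spike p i by rewrite /spike opprB addrA subrK.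
have slow x y : r ^+ onorm l * spike p x <= spike p y ->
    spike p x - spike p y <= (1 - r ^+ onorm l) * spike p x.
  by move=> ?; rewrite mulrBl mul1r lerB.
have le x y : (onorm (y - p) <= onorm l + onorm (x - p))%N ->
    r ^+ onorm l * spike p x <= spike p y.
  by move=> ?; rewrite -exprD ler_wiXn2l// ltW.
have tl : (onorm (i - l - p) <= onorm l + onorm (i - p))%N.
  by rewrite addrAC addrC -[in leqRHS](onormN l) onormD.
have tr : (onorm (i - p) <= onorm l + onorm (i - l - p))%N.
  by rewrite (leq_trans _ (onormD _ _))// addrCA addrA subrK addrC.
have b1 := spike_ge0 p i; have b2 := spike_ge0 p (i - l).
have s1 := slow _ _ (le _ _ tl); have s2 := slow _ _ (le _ _ tr).
have h1 := mulr_ge0 (shrink01 l) b1; have h2 := mulr_ge0 (shrink01 l) b2.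
rewrite mulrDr ler_norml; apply/andP; split.
  by rewrite lerNl opprB (le_trans s1)// lerDr.
by rewrite (le_trans s2)// lerDl.
Qed.

Variables (S T : ell2 R d -> ell2 R d) (C : R).
Hypotheses (C0 : 0 < C)
  (SC : forall (x : ell2 R d) B, 0 <= B -> l2_le x B -> l2_le (S x) (C * B)).
Hypotheses (TA : forall x, T x = mxact A x :> cseq R d) (TK : cancel T S).

Definition local_le (x : 'rV[int]_d -> R[i]) (p : 'rV[int]_d) (B : R) : Prop :=
  bsum (fun k => (spike p k * normc (x k)) ^+ 2) (B ^+ 2).

(** Let x be [u] times the bump at [p]. Since S (T x) = x, its norm is at most [C] times that of T
    x, which is the bump times [T u] plus a commutator; Minkowski's inequality bounds the commutator
    by [M]. *)
Lemma local_inverse_estimate (u : ell2 R d) (alpha : 'rV[int]_d -> R) p B M :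
  (forall k, 0 <= alpha k) -> (forall k, local_le u k (alpha k)) ->
  0 <= B -> local_le (T u) p B ->
  bsum (fun l => D l * (1 - r ^+ onorm l) * (alpha p + alpha (p - l))) M ->
  local_le u p (C * (B + M)).
Proof.
move=> alpha0 ualpha B0 vB cM.
have M0 : 0 <= M by exact: bsum_ge0 cM.
pose f : cseq R d := fun k => (spike p k)%:C%C * u k.
have fE k : normc (f k) = spike p k * normc (u k).
  by rewrite normcM normc_real ger0_norm ?spike_ge0.
have [x xf] : exists x : ell2 R d, x = f :> cseq R d.
  apply: (ell2_mk (alpha0 p)); move: (ualpha p); rewrite /local_le /l2_le.
  by congr bsum; apply/funext => k; rewrite fE.
have [U U0 uU] := ell2P u.
have uU' k : normc (u k) <= U by exact: l2_le_sup.
have fU k : normc (f k) <= U.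
  by rewrite fE -[leRHS]mul1r ler_pM ?spike_ge0 ?spike_le1 ?normc_ge0.
suff TxM : l2_le (T x) (B + M).
  have := SC (addr_ge0 B0 M0) TxM; rewrite TK xf /local_le /l2_le.
  by congr bsum; apply/funext => k; rewrite fE.
(* The function [h l] is the translate by [l] of [u] times the sum of the bumps at [p] and [p - l],
   so its l^2 norm is at most [alpha p + alpha (p - l)]. *)
pose h l i := (spike p (i - l) + spike (p - l) (i - l)) * normc (u (i - l)).
pose c l := D l * (1 - r ^+ onorm l).
have c0 l : 0 <= c l by rewrite mulr_ge0.
have h0 l i : 0 <= h l i by rewrite mulr_ge0 ?addr_ge0 ?spike_ge0 ?normc_ge0.
have hM i : bsum (fun l => c l * h l i) (E * (U + U)).
  have uu k : 0 <= normc (u k) + normc (u k) by rewrite addr_ge0 ?normc_ge0.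
  apply: le_bsum (bsum_conv i D0 uu DE (fun k => lerD (uU' k) (uU' k))) => l.
  rewrite ler_pM// ?ler_piMr ?gerBl ?exprn_ge0 ?(ltW r0)//.
  by rewrite /h mulrDl lerD// ler_piMl ?normc_ge0 ?spike_le1.
apply: (l2_minkowski (a := fun i => spike p i * normc (T u i)) (h := h) (c := c)
    (t := fun l => alpha p + alpha (p - l))) => //.
- by move=> i; exact: normc_ge0.
- by move=> l; rewrite addr_ge0.
(* The terms [diff j] make up the commutator at [i]. With l = i - j, the bounds on the matrix entry
   and on the bump difference give [c l * h l i]. *)
- move=> i; pose diff j := (spike p j - spike p i)%:C%C * (A i j * u j).
  have su := has_csumP (bsum_row i uU'); have sf := has_csumP (bsum_row i fU).
  have := has_csumD sf (has_csumZ (- (spike p i)%:C%C) su).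
  rewrite -[csum _]/(mxact A f i) -[X in _ * X]/(mxact A u i) -xf -!TA xf => sd.
  have {}sd : has_csum diff (T x i - (spike p i)%:C%C * T u i).
    move: sd; rewrite mulNr; congr has_csum; apply/funext => j.
    by rewrite /diff /f rmorphB/=; ring.
  rewrite -[T x i](subrK ((spike p i)%:C%C * T u i)) addrC.
  rewrite (le_trans (le_normcD _ _))// normcM normc_real ger0_norm ?spike_ge0// lerD2l.
  apply: (has_csum_norm sd).
  have := bsum_inj (e := fun j => i - j) _ (bsum_tsum (hM i)).
  move=> iM; apply: le_bsum (iM _) => [j|k l /addrI/oppr_inj//] /=.
  rewrite /diff !normcM normc_real /c /h subKr.
  rewrite !mulrA ler_wpM2r ?normc_ge0//.
  have := spike_diff p i (i - j); rewrite subKr => bd.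
  by rewrite [leLHS]mulrC -[leRHS]mulrA ler_pM ?normc_ge0.
- move=> l; have ab := bsum_sqrD (alpha0 p) (alpha0 (p - l)) (ualpha p) (ualpha (p - l)).
  have := bsum_inj (e := fun i => i - l) _ ab.
  by move=> iM; apply: le_bsum (iM _) => [i|k m /addIr//]; rewrite /= /h mulrDl.
Qed.

End localization.

(** * Off-diagonal decay of the inverse by iteration *)

Section inverse_decay_iteration.
Variables (R : realType) (d : nat) (q p : R).
Hypotheses (q01 : 0 < q <= 1) (p0 : 0 <= p).
Variables (A : 'rV[int]_d -> 'rV[int]_d -> R[i]) (D : 'rV[int]_d -> R) (W : R).
Hypotheses (D0 : forall k, 0 <= D k) (DW : wsum q p D W).
Hypothesis AD : forall i j, normc (A i j) <= D (i - j).
Variables (S T : ell2 R d -> ell2 R d) (C : R).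
Hypotheses (C0 : 0 < C)
  (SC : forall (x : ell2 R d) B, 0 <= B -> l2_le x B -> l2_le (S x) (C * B)).
Hypotheses (TA : forall x, T x = mxact A x :> cseq R d).
Hypotheses (TK : cancel T S) (SK : cancel S T).

Let q0 : 0 < q. Proof. by case/andP: q01. Qed.

(* The constant part of the bound is halved at each step, while the summable
   part obeys a contraction in [wsum]: both because the commutator weights
   [D l * (1 - r ^+ onorm l)] are small for [r] close to [1]. *)
Lemma inverse_decay_iter : exists N, forall m : nat, exists2 b : 'rV[int]_d -> R,
  (forall k, 0 <= b k) /\ wsum q p b N &
  forall i j, normc (S (unit_vector R j) i) <= b (i - j) + C / 2 ^+ m.
Proof.
(* The first entry yields 4 C E <= 1, which halves the constant part; the second yields 4 C^q eta <=
   1, which lets the summable part keep the bound [N]. *)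
pose eta := Num.min ((4 * C)^-1 `^ q) ((4 * C `^ q)^-1).
have Cq0 : 0 < C `^ q by exact: powR_gt0.
have C4 : 0 < 4 * C by rewrite mulr_gt0.
have eta0 : 0 < eta by rewrite lt_min powR_gt0 ?invr_gt0// mulr_gt0.
have [r r01 cW] := wsum_shrink q01 D0 DW eta0.
have /andP[r0 r1] := r01.
pose c k := D k * (1 - r ^+ onorm k).
have c0 k : 0 <= c k.
  by rewrite mulr_ge0// subr_ge0 exprn_ile1 ?(ltW r0) ?(ltW r1).
pose E := eta `^ q^-1; have E0 : 0 <= E by exact: powR_ge0.
have cE : bsum c E by move: (wsum_bsum q01 p0 c0 cW).
have Eq : E `^ q = eta by rewrite -powRrM mulVf ?gt_eqF// powRr1// ltW.
have CE : 4 * C * E <= 1.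
  rewrite mulrC -ler_pdivlMr// mul1r.
  have -> : (4 * C)^-1 = ((4 * C)^-1 `^ q) `^ q^-1.
    by rewrite -powRrM divff ?gt_eqF// powRr1// invr_ge0 ltW.
  rewrite ge0_ler_powR ?nnegrE ?powR_ge0 ?invr_ge0 ?(ltW q0) ?(ltW eta0)//.
  by rewrite ge_min lexx.
have Ceta : 4 * C `^ q * eta <= 1.
  by rewrite mulrC -ler_pdivlMr ?mulr_gt0// mul1r ge_min lexx orbT.
have [N0 HN0] : exists N0, bsum (fun k : 'rV[int]_d => (r ^+ onorm k) `^ q * wt p k) N0.
  have [|N0 HN0] := @bsum_geometric_wt R d p (r `^ q) p0.
    rewrite powR_gt0//= -[ltRHS](powRr1 ler01) -[X in _ < X]/(1 `^ 1).
    have p1 : 1 `^ q = 1 :> R by rewrite powR1.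
    by rewrite powRr1// -[ltRHS]p1 gt0_ltr_powR ?nnegrE ?ler01 ?(ltW r0).
  exists N0; apply: le_bsum HN0 => k.
  apply: ler_wpM2r; first exact: wt_ge0.
  by rewrite (powR_exprn _ _ (ltW r0)).
have N00 : 0 <= N0 by exact: bsum_ge0 HN0.
(* With this choice C^q N0 equals N / 2, while C^q times 2 eta N is at most N / 2. *)
pose N := 2 * C `^ q * N0.
exists N => m.
(* The induction needs the localized norms around every [k]; a matrix entry is recovered at the
   centre of the bump, where its value is 1. *)
suff [b [b0 bN] Sb] : exists2 b : 'rV[int]_d -> R, (forall k, 0 <= b k) /\ wsum q p b N &
    forall j k, local_le r (S (unit_vector R j)) k (b (k - j) + C / 2 ^+ m).
  exists b => // i j; have := bsum_term i (Sb j i).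
  rewrite spike_id mul1r ler_sqr ?nnegrE ?normc_ge0 ?addr_ge0 ?divr_ge0 ?exprn_ge0//.
  exact: ltW.
elim: m => [|m [b [b0 bN] Sb]].
  exists (fun=> 0).
    split=> // F; rewrite big1 ?mulr_ge0 ?(ltW Cq0)// => k _.
    by rewrite powR0 ?mul0r ?gt_eqF.
  move=> j k; rewrite add0r expr0 divr1.
  have := SC ler01; move=> /(_ (unit_vector R j)); rewrite unit_vectorE mulr1.
  move=> /(_ (@l2_le_kdelta R d j)); apply: le_bsum => i.
  rewrite exprMn ler_piMl ?sqr_ge0// exprn_ile1 ?spike_ge0 ?spike_le1//.
pose g := C / 2 ^+ m; have g0 : 0 <= g by rewrite divr_ge0 ?exprn_ge0 ?(ltW C0).
have bB k : b k <= N `^ q^-1 := wsum_sup q01 p0 k b0 bN.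
pose cb n := tsum (fun l => c l * b (n - l)).
have cbM n := bsum_conv n c0 b0 cE bB.
have cb0 n : 0 <= cb n by exact: tsum_ge0 (cbM n).
(* The new profile is read off the local estimate: T (S e_j) = e_j contributes r^|n|, the [alpha k]
   part contributes [E * b n], and the [alpha (k - l)] part the convolution [cb]. *)
exists (fun n => C * (r ^+ onorm n + (E * b n + cb n))).
  have rn0 (n : 'rV[int]_d) : 0 <= r ^+ onorm n by rewrite exprn_ge0// ltW.
  have Eb0 n : 0 <= E * b n by rewrite mulr_ge0.
  have Ecb0 n : 0 <= E * b n + cb n by rewrite addr_ge0.
  have sum0 n : 0 <= r ^+ onorm n + (E * b n + cb n) by rewrite addr_ge0.
  split; first by move=> k; rewrite mulr_ge0 ?(ltW C0).
  have bW := wsumD q01 Eb0 cb0 (wsumZ E0 b0 bN) (wsum_conv q01 p0 c0 b0 cW bN).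
  have {}bW := wsumZ (ltW C0) sum0 (wsumD q01 rn0 Ecb0 HN0 bW).
  apply: (bsum_le _ bW).
  rewrite Eq; have N1 : 0 <= N by rewrite !mulr_ge0// ltW.
  have := ler_wpM2r N1 Ceta; rewrite /N; nra.
move=> j k; pose alpha n := b (n - j) + g.
have alpha0 n : 0 <= alpha n by rewrite addr_ge0.
have rj0 : 0 <= r ^+ onorm (j - k) by rewrite exprn_ge0// ltW.
have Tj : local_le r (T (S (unit_vector R j))) k (r ^+ onorm (j - k)).
  rewrite SK unit_vectorE /local_le.
  have := @bsum_kdelta R d (fun i => (spike r k i * normc (kdelta R j i)) ^+ 2) j.
  rewrite normc_kdelta eqxx mulr1; apply; first exact: sqr_ge0.
  by move=> i /negPf ij; rewrite normc_kdelta ij mulr0 expr0n.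
have DE' : bsum D (W `^ q^-1) := wsum_bsum q01 p0 D0 DW.
have cM : bsum (fun l => D l * (1 - r ^+ onorm l) * (alpha k + alpha (k - l)))
    ((E * b (k - j) + cb (k - j)) + 2 * g * E).
  have s1 := bsumZ (b0 (k - j)) cE; have s2 := bsum_tsum (cbM (k - j)).
  have s3 : bsum (fun l => 2 * g * c l) (2 * g * E) by apply: bsumZ cE; rewrite mulr_ge0.
  rewrite [E * _]mulrC; apply: le_bsum (bsumD (bsumD s1 s2) s3) => l.
  rewrite /alpha (_ : k - l - j = k - j - l) 1?addrAC// -/(c l).
  by rewrite le_eqVlt; apply/orP; left; apply/eqP; ring.
have := local_inverse_estimate D0 DE' AD r01 SC TA TK alpha0 (Sb j) rj0 Tj cM.
apply: bsum_le; rewrite ler_sqr ?nnegrE; last first.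
- by rewrite !addr_ge0 ?mulr_ge0 ?addr_ge0 ?divr_ge0 ?mulr_ge0 ?exprn_ge0 ?(ltW C0) ?(ltW r0).
- by rewrite !mulr_ge0 ?addr_ge0 ?mulr_ge0 ?(ltW C0).
have -> : C / 2 ^+ m.+1 = g / 2 by rewrite exprS invfM [2^-1 * _]mulrC mulrA.
have CEg := ler_wpM2r g0 CE; rewrite onormB addrA mulrDr lerD2l.
rewrite mul1r in CEg; rewrite (_ : C * _ = 4 * C * E * g / 2); last by field.
by rewrite ler_wpM2r ?invr_ge0.
Qed.

End inverse_decay_iteration.

(** * Inverse-closedness of the matrix algebra and of the convolution algebra *)

Section inverse_closedness.
Variables (R : realType) (d : nat).
Implicit Types k : 'rV[int]_d.

Lemma sum_ellval (q : {posnum R}) (s : R) (I : Type) (r : seq I) (f : I -> ellspace d q s) k :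
  (\sum_(i <- r) f i) k = \sum_(i <- r) f i k.
Proof. by elim: r => [|i r IHr]; rewrite ?big_nil ?big_cons//= -IHr. Qed.

Lemma sum_kdelta (F : {fset 'rV[int]_d}) (f : 'rV[int]_d -> R[i]) k :
  \sum_(j <- F) f j * kdelta R j k = if k \in F then f k else 0.
Proof.
case: ifPn => kF.
  rewrite (big_fsetD1 k)//= /kdelta eqxx mulr1 big1_seq ?addr0// => j.
  by rewrite !inE eq_sym => /andP[_ /andP[/negPf->]]; rewrite mulr0.
rewrite big1_seq// => j /= jF; rewrite /kdelta; case: eqP => [kj|_]; last by rewrite mulr0.
by rewrite kj jF in kF.
Qed.

(** Finite truncations of [x] converge in l^2, and boundedness of [S] carries this over to every
    coordinate. Hence a bounded operator acts as the matrix with columns S e_j. *)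
Lemma linear_matrix_sum (S : ell2 R d -> ell2 R d) (x : ell2 R d) i : bounded_ops R d S ->
  has_csum (fun j => S (unit_vector R j) i * x j) (S x i).
Proof.
move=> Sb e e0; have [C C0 SC] := bounded_opsP Sb; have [Slin _] := Sb.
have [X X0 xX] := ell2P x.
pose t := e / 2 / C; have t0 : 0 < t by rewrite !divr_gt0.
have [F HF] := bsum_tail (fun k => sqr_ge0 _) xX (exprn_gt0 2 t0).
exists F => G FG; pose z := x - \sum_(j <- G) x j *: unit_vector R j.
have zt : l2_le z t.
  apply: le_bsum HF => k.
  have -> : z k = x k - \sum_(j <- G) (x j *: unit_vector R j) k by rewrite -sum_ellval.
  under eq_bigr => j _ do rewrite [_ k]/(x j * (unit_vector R j : cseq R d) k) unit_vectorE.
  rewrite sum_kdelta; case: ifPn => [kG|kG]; last first.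
    by rewrite subr0 ifN//; apply: contra kG; apply/fsubsetP.
  by rewrite subrr normc0 expr0n; case: ifP => _ //; rewrite sqr_ge0.
have Sz : S z i = S x i - \sum_(j <- G) S (unit_vector R j) i * x j.
  rewrite /z; elim: (enum_fset G) => [|j r IHr]; first by rewrite !big_nil !subr0.
  rewrite !big_cons [_ *: _ + _]addrC opprD addrA addrC -scaleNr Slin.
  rewrite [LHS]/(- x j * S (unit_vector R j) i +
    S (x - \sum_(k <- r) x k *: unit_vector R k) i) IHr.
  have aux (a b c e' : R[i]) : - a * b + (c - e') = c - (b * a + e') by ring.
  exact: aux.
rewrite -Sz; have Ct0 : 0 <= C * t by rewrite mulr_ge0 ?ltW.
apply: (le_lt_trans (l2_le_sup i Ct0 (SC _ _ (ltW t0) zt))).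
by rewrite /t mulrC divfK ?gt_eqF// gtr_pMr// invf_lt1// ltr1n.
Qed.

Variables (q s : R).
Hypotheses (q01 : 0 < q <= 1) (s0 : 0 <= s).
Let q0 : 0 < q. Proof. by case/andP: q01. Qed.
Let p0 : 0 <= s * q. Proof. by rewrite mulr_ge0// ltW. Qed.

Lemma ell_wsum (a : cseq R d) :
  ell d q s a <-> exists M, wsum q (s * q) (fun k => normc (a k)) M.
Proof. exact: ell_bsum. Qed.

(** The decay profiles share the bound [N] for all [m] while the constant part tends to 0, so the
    suprema along the diagonals of the inverse satisfy the same bound. *)
Lemma inverse_decay (A : 'rV[int]_d -> 'rV[int]_d -> R[i]) (D : 'rV[int]_d -> R) W
    (S T : ell2 R d -> ell2 R d) :
  (forall k, 0 <= D k) -> wsum q (s * q) D W -> (forall i j, normc (A i j) <= D (i - j)) ->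
  bounded_ops R d S -> (forall x, T x = mxact A x :> cseq R d) ->
  cancel T S -> cancel S T ->
  convdom (ell d q s) (fun i j => S (unit_vector R j) i).
Proof.
move=> D0 DW AD Sb TA TK SK; have [C C0 SC] := bounded_opsP Sb.
have [N HN] := inverse_decay_iter q01 p0 D0 DW AD C0 SC TA TK SK.
pose f n k := normc (S (unit_vector R (k - n)) k).
have fC n k : f n k <= C.
  have := SC (unit_vector R (k - n)) 1 ler01; rewrite unit_vectorE mulr1.
  by move/(_ (l2_le_kdelta R (k - n))); apply: l2_le_sup; exact: ltW.
have f0 n k : 0 <= f n k by exact: normc_ge0.
have fne n : range (f n) !=set0 by exists (f n 0); exists 0.
have fub n : has_ubound (range (f n)) by exists C => _ [k _ <-].
have sup0 n : 0 <= sup (range (f n)).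
  by apply: le_trans (f0 n 0) _; apply: ub_le_sup => //; exists 0.
split=> //; apply/ell_wsum; exists N; apply: (wsum_approx q01) => [n|t t0].
  exact: normc_ge0.
have [m Cm] := div_pow2_small (ltW C0) t0.
have [b [b0 bN] Sbd] := HN m; exists b => // n.
rewrite normc_real ger0_norm; last exact: sup0.
apply: (ge_sup (fne n)) => _ [k _ <-].
by apply: le_trans (Sbd _ _) _; rewrite subKr lerD2l.
Qed.

Lemma convdom_ops_inverse_closed :
  inverse_closed (convdom_ops (ell d q s)) (bounded_ops R d).
Proof.
move=> T S [A [Aub AB] TA] Sb TK SK.
pose D n := sup (range (fun k => normc (A k (k - n)))).
have fD n k : normc (A k (k - n)) <= D n by apply: ub_le_sup => //; exists k.
have D0 n : 0 <= D n by exact: le_trans (normc_ge0 _) (fD n 0).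
have /ell_wsum[W DW] := AB.
have {}DW : wsum q (s * q) D W.
  by refine (le_wsum q01 _ DW) => n; rewrite D0 normc_real ler_norm.
have AD i j : normc (A i j) <= D (i - j) by rewrite -{1}[j](subKr i).
exists (fun i j => S (unit_vector R j) i); first exact: inverse_decay TA TK SK.
by move=> x; apply/funext => i; rewrite /mxact (csumE (linear_matrix_sum x i Sb)).
Qed.

Lemma conv_ops_inverse_closed :
  inverse_closed (conv_ops (ell d q s)) (bounded_ops R d).
Proof.
move=> T S [a /[dup] aB /ell_wsum[W aW] Ta] Sb TK SK.
pose A i j := a (i - j).
have a0 k : 0 <= normc (a k) by exact: normc_ge0.
have aE : bsum (fun k => normc (a k)) (W `^ q^-1) := wsum_bsum q01 p0 a0 aW.
(* The convolution operator is the matrix with entries [a (i - j)], after the substitution of n - k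
   for k. *)
have TA x : T x = mxact A x :> cseq R d.
  rewrite Ta; apply/funext => n; have [X X0 /l2_le_sup xX] := ell2P x.
  have := has_csumP (bsum_row a0 aE (fun i j => lexx _) n (fun k => xX k X0)).
  move=> /(has_csum_bij (e := fun k => n - k) (e' := fun k => n - k)).
  move=> /(_ (subKr _) (subKr _)) h; rewrite /mxact -(csumE h); congr csum.
  by apply/funext => k /=; rewrite /A subKr.
have [Sub /ell_wsum[N HN]] := inverse_decay a0 aW (fun i j => lexx _) Sb TA TK SK.
have shiftP (x : ell2 R d) j : exists y : ell2 R d, y = (fun k => x (k - j)) :> cseq R d.
  have [X X0 xX] := ell2P x; apply: (ell2_mk X0).
  by apply: (bsum_inj (e := fun k => k - j) _ xX) => k l /addIr.
(* [S] commutes with translations: [T] maps the translate by [j] of S e_0 to e_j, so [S] maps e_j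
   back to that translate. *)
have Sj i j : S (unit_vector R j) i = S (unit_vector R 0) (i - j).
  have [y yE] := shiftP (S (unit_vector R 0)) j.
  suff <- : y = S (unit_vector R j) by rewrite yE.
  rewrite -[y]TK; congr (S _); apply: val_inj; apply/funext => n /=.
  have := SK (unit_vector R 0) => /(congr1 (fun z : ell2 R d => z (n - j))).
  rewrite !Ta !unit_vectorE /kdelta subr_eq0 => <-.
  by rewrite /Defs.conv; congr csum; apply/funext => k; rewrite yE addrAC.
(* The inverse sequence is the column at 0. By translation invariance its modulus at [n] is one of
   the entries whose supremum is the profile at [n]. *)
exists (S (unit_vector R 0)).
  apply/ell_wsum; exists N; refine (le_wsum q01 _ HN) => n; rewrite normc_ge0 normc_real.
  apply: le_trans (ler_norm _); apply: (ub_le_sup (Sub n)).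
  by exists 0; rewrite // Sj subKr.
move=> x; apply/funext => n; rewrite /Defs.conv; apply/esym/csumE.
have := has_csum_bij (e := fun k => n - k) (e' := fun k => n - k) (subKr _) (subKr _)
  (linear_matrix_sum x n Sb).
by congr has_csum; apply/funext => k /=; rewrite Sj subKr.
Qed.

End inverse_closedness.

(** * Neumann series *)

Section neumann.
Variables (R : realType) (d : nat).
Implicit Types (k n : 'rV[int]_d).

(** With g m = 2 / 2^m, the intervals from [u m - g m] to [u m + g m] are nested, and the supremum
    of the left ends lies in all of them. *)
Lemma geometric_limit (u : nat -> R) :
  (forall m, `|u m.+1 - u m| <= 2^-1 ^+ m) ->
  exists l, forall m, `|l - u m| <= 2 * 2^-1 ^+ m.
Proof.
move=> hu; pose g m : R := 2 * 2^-1 ^+ m.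
have gS m : g m.+1 = g m - 2^-1 ^+ m by rewrite /g exprS; field.
have g0 m : 0 <= g m by rewrite mulr_ge0 ?exprn_ge0 ?invr_ge0.
have step m : u m - g m <= u m.+1 - g m.+1 /\ u m.+1 + g m.+1 <= u m + g m.
  by have := hu m; rewrite ler_norml gS => /andP[]; lra.
have vm : {homo (fun m => u m - g m) : i j / (i <= j)%N >-> i <= j}.
  by apply: homo_leq => // [x y z|m]; [exact: le_trans|case: (step m)].
have wm : {homo (fun m => u m + g m) : i j / (i <= j)%N >-> j <= i}.
  apply: (@homo_leq _ _ (fun x y => y <= x)) => // [x y z xy yz|m].
    exact: le_trans yz xy.
  by case: (step m).
have vw i j : u i - g i <= u j + g j.
  case/orP: (leq_total i j) => ij.
    by apply: le_trans (vm _ _ ij) _; have := g0 j; lra.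
  by apply: le_trans (wm _ _ ij); have := g0 i; lra.
exists (sup (range (fun m => u m - g m))) => m.
rewrite ler_distl; apply/andP; split.
  by apply: ub_le_sup; [exists (u 0%N + g 0%N) => _ [i _ <-]|exists m].
by apply: ge_sup => [|_ [i _ <-]]; [exists (u 0%N - g 0%N); exists 0%N|].
Qed.

Lemma geometric_climit (u : nat -> R[i]) :
  (forall m, normc (u m.+1 - u m) <= 2^-1 ^+ m) ->
  exists l, forall m, normc (l - u m) <= 4 * 2^-1 ^+ m.
Proof.
move=> hu.
have [m|a ha] := @geometric_limit (fun m => complex.Re (u m)).
  rewrite -raddfB -normc_real; apply: le_trans (hu m).
  by case: (normc_real_le (u m.+1 - u m)).
have [m|b hb] := @geometric_limit (fun m => complex.Im (u m)).
  rewrite -raddfB -normc_real; apply: le_trans (hu m).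
  by case: (normc_real_le (u m.+1 - u m)).
exists (a%:C + 'i * b%:C)%C => m.
rewrite [u m]complexE opprD addrACA -mulrBr -!rmorphB/= (le_trans (le_normcD _ _))//.
have -> : 4 * 2^-1 ^+ m = 2 * 2^-1 ^+ m + 2 * 2^-1 ^+ m :> R by ring.
rewrite normcM !normc_real lerD//.
by rewrite /normc/= expr0n/= add0r expr1n sqrtr1 mul1r.
Qed.

Variables (q p : R).
Hypotheses (q01 : 0 < q <= 1) (p0 : 0 <= p).
Let q0 : 0 < q. Proof. by case/andP: q01. Qed.

Lemma wsum_kdelta j : wsum q p (fun k => normc (kdelta R j k)) (wt p j).
Proof.
have := @bsum_kdelta R d (fun k => normc (kdelta R j k) `^ q * wt p k) j.
rewrite normc_kdelta eqxx powR1 mul1r; apply; first exact: wt_ge0.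
by move=> k /negPf kj; rewrite normc_kdelta kj powR0 ?mul0r ?gt_eqF.
Qed.

Variables (a : cseq R d) (E : R).
Hypothesis aE : bsum (fun k => normc (a k)) E.
Let a0 k : 0 <= normc (a k). Proof. exact: normc_ge0. Qed.

Lemma bsum_convc (x : cseq R d) X n : (forall k, normc (x k) <= X) ->
  bsum (fun k => normc (a k * x (n - k))) (E * X).
Proof.
move=> xX; apply: le_bsum (bsum_conv n a0 (fun k => normc_ge0 (x k)) aE xX) => k.
by rewrite normcM.
Qed.

Lemma normc_convB (x y : cseq R d) X Y Z n :
  (forall k, normc (x k) <= X) -> (forall k, normc (y k) <= Y) ->
  (forall k, normc (x k - y k) <= Z) ->
  normc (Defs.conv a x n - Defs.conv a y n) <= E * Z.
Proof.
move=> xX yY xyZ.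
have hx := has_csumP (bsum_convc n xX); have hy := has_csumP (bsum_convc n yY).
have := has_csum_norm (has_csumD hx (has_csumZ (-1) hy)).
rewrite mulN1r; apply; apply: le_bsum (bsum_convc n xyZ) => k.
by rewrite mulN1r -mulrBr.
Qed.

Hypothesis aM : wsum q p (fun k => normc (a k)) 2^-1.
Hypothesis E2 : E <= 2^-1.

(** Iteration from 0 towards the fixed point, which is the convolution inverse of delta - a. Each
    step preserves the bound 2 = 1 + 2 / 2 on the [q]-th power of the quasi-norm, and in the sup
    norm the increments are halved because the l^1 norm of [a] is at most 1/2. *)
Lemma neumann : exists2 c : cseq R d, wsum q p (fun k => normc (c k)) 2 &
  forall n, c n = kdelta R 0 n + Defs.conv a c n.
Proof.
pose next (x : cseq R d) : cseq R d := fun n => kdelta R 0 n + Defs.conv a x n.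
pose c m := iter m next (fun=> 0).
have x0 (x : cseq R d) k : 0 <= normc (x k) by exact: normc_ge0.
have cW m : wsum q p (fun k => normc (c m k)) 2.
  elim: m => [|m IHm].
    by move=> F; rewrite big1// => k _; rewrite normc0 powR0 ?mul0r ?gt_eqF.
  have cm := fun k => wsum_sup q01 p0 k (x0 (c m)) IHm.
  have b0 n : 0 <= tsum (fun k => normc (a k) * normc (c m (n - k))).
    by apply: tsum_ge0 (bsum_conv n a0 (x0 (c m)) aE cm).
  have := wsumD q01 (x0 (kdelta R 0)) b0 (wsum_kdelta 0)
    (wsum_conv q01 p0 a0 (x0 (c m)) aM IHm).
  rewrite wt0 mulVf// => cS; refine (le_wsum q01 _ (_ : wsum q p _ 2)); last exact: cS.
  move=> n; rewrite x0/= (le_trans (le_normcD _ _))// lerD2l.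
  apply: normc_csum; under eq_fun do rewrite normcM.
  exact: bsum_tsum (bsum_conv n a0 (x0 (c m)) aE cm).
pose X : R := 2 `^ q^-1; have cX m k : normc (c m k) <= X := wsum_sup q01 p0 k (x0 _) (cW m).
have E0 : 0 <= E := bsum_ge0 aE.
have cS m k : normc (c m.+1 k - c m k) <= 2^-1 ^+ m.
  elim: m k => [|m IHm] k.
    rewrite expr0 subr0 (le_trans (le_normcD _ _))// normc_kdelta.
    have : normc (Defs.conv a (fun=> 0) k) <= E * 0.
      by apply: normc_csum; apply: (@bsum_convc (fun=> 0) 0 k) => j; rewrite normc0.
    rewrite mulr0 => h; apply: le_trans (lerD (lexx _) h) _.
    by rewrite addr0; case: (k == 0).
  rewrite [c m.+2]/(next (c m.+1)) [c m.+1]/(next (c m)) /next opprD addrACA subrr add0r.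
  apply: le_trans (normc_convB k (cX m.+1) (cX m) IHm) _.
  by rewrite exprS ler_wpM2r ?exprn_ge0 ?invr_ge0.
have lim k := @geometric_climit (fun m => c m k) (fun m => cS m k).
pose l k := projT1 (cid (lim k)).
have lc k m : normc (l k - c m k) <= 4 * 2^-1 ^+ m := projT2 (cid (lim k)) m.
have small (C t : R) : 0 <= C -> 0 < t -> exists m, C * 2^-1 ^+ m <= t.
  by move=> C0 /(div_pow2_small C0)[m Cm]; exists m; rewrite exprVn.
exists l.
  apply: (wsum_approx q01) => [k|t t0]; first exact: normc_ge0.
  have [m Cm] := small 4 t (ler0n _ 4) t0.
  exists (fun k => normc (c m k)) => [|k]; first by split=> // k; exact: normc_ge0.
  rewrite -[l k](subrK (c m k)) addrC (le_trans (le_normcD _ _))// lerD2l.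
  exact: le_trans (lc k m) Cm.
move=> n; apply/eqP; rewrite -subr_eq0; apply/eqP/eq0_normc/eqP.
rewrite eq_le normc_ge0 andbT; apply/ler_addgt0Pr => t t0; rewrite add0r.
have [m Cm] := small 4 t (ler0n _ 4) t0.
have lX k : normc (l k) <= X + 4.
  rewrite -[l k](subrK (c 0 k)) addrC (le_trans (le_normcD _ _))// lerD//.
  by have := lc k 0%N; rewrite expr0 mulr1.
(* Inserting the iterate m + 1, which is [next] of the iterate m, leaves two errors of at most 2 /
   2^m each. *)
rewrite (_ : l n - _ = (l n - c m.+1 n) + (Defs.conv a (c m) n - Defs.conv a l n)); last first.
  have aux (x y u v : R[i]) : x - (y + v) = x - (y + u) + (u - v) by ring.
  exact: aux.
apply: (le_trans (le_normcD _ _)); apply: le_trans Cm.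
have cl k : normc (c m k - l k) <= 4 * 2^-1 ^+ m by rewrite normcB.
apply: le_trans (lerD (lc n m.+1) (normc_convB n (cX m) lX cl)) _.
have y0 : 0 <= 2^-1 ^+ m :> R by rewrite exprn_ge0 ?invr_ge0.
have := ler_wpM2r y0 E2; rewrite exprS; lra.
Qed.

End neumann.

(** * Characters *)

Section exponentials.
Variable R : realType.

Lemma expiD (x y : R) : expi (x + y) = expi x * expi y.
Proof.
rewrite /expi cosD sinD; apply/eqP.
by rewrite eq_complex /= addrC eqxx addrC [_ * _ + _]addrC eqxx.
Qed.

Lemma expi0 : expi (0 : R) = 1.
Proof. by rewrite /expi cos0 sin0. Qed.

Lemma expi_neq0 (x : R) : expi x != 0.
Proof.
apply/eqP => h; have := expiD x (- x); rewrite subrr expi0 h mul0r.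
by move/eqP; rewrite oner_eq0.
Qed.

Lemma expiN (x : R) : expi (- x) = (expi x)^-1.
Proof.
by apply: (mulfI (expi_neq0 x)); rewrite -expiD subrr expi0 divff ?expi_neq0.
Qed.

(** Take plus or minus the arc cosine of the real part, according to the sign of the imaginary
    part. *)
Lemma expi_surj (z : R[i]) : normc z = 1 -> exists x, z = expi x.
Proof.
case: z => a b; rewrite /normc/= => ab1.
have {}ab1 : a ^+ 2 + b ^+ 2 = 1.
  by rewrite -[LHS]sqr_sqrtr ?addr_ge0 ?sqr_ge0// ab1 expr1n.
have a1 : -1 <= a <= 1.
  rewrite -ler_norml -[leRHS](normr1 R) -ler_sqr ?nnegrE// !real_normK ?num_real//.
  by rewrite expr1n -ab1 lerDl sqr_ge0.
have sa : Num.sqrt (1 - a ^+ 2) = `|b|.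
  by rewrite -ab1 addrAC subrr add0r sqrtr_sqr.
have [b0|b0] := leP 0 b.
  by exists (acos a); rewrite /expi acosK ?in_itv// sin_acos// sa ger0_norm.
exists (- acos a); rewrite /expi cosN sinN acosK ?in_itv// sin_acos// sa.
by rewrite ltr0_norm// opprK.
Qed.

End exponentials.

(** * Characters of the sequence algebra are points of the torus *)

Section characters.
Variables (R : realType) (d : nat) (q : {posnum R}) (s : R).
Hypotheses (q1 : q%:num <= 1) (s0 : 0 <= s).
Implicit Types (j k n : 'rV[int]_d) (a b : ellspace d q s).

Let p : R := s * q%:num.
Let p0 : 0 <= p. Proof. by rewrite mulr_ge0. Qed.
Let q01 : 0 < q%:num <= 1. Proof. by rewrite gt0. Qed.
Let q0 : 0 < q%:num. Proof. exact: gt0. Qed.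

Definition lqs_le (f : 'rV[int]_d -> R[i]) (M : R) : Prop :=
  wsum q%:num p (fun k => normc (f k)) M.

Lemma ellspaceP a : exists M, lqs_le a M.
Proof. by have := ellvalP a; rewrite inE => /(ell_wsum q01 s0). Qed.

Lemma ellspace_mk (f : cseq R d) M : lqs_le f M -> exists a, a = f :> cseq R d.
Proof.
move=> fM; have fP : f \in ellpred (d := d) q s.
  by rewrite inE; apply/(ell_wsum q01 s0); exists M.
by exists (EllSpace fP).
Qed.

Lemma delta_exists j : exists a, a = kdelta R j :> cseq R d.
Proof. exact: ellspace_mk (wsum_kdelta p q01 j). Qed.

Definition delta j : ellspace d q s := projT1 (cid (delta_exists j)).

Lemma deltaE j : delta j = kdelta R j :> cseq R d.
Proof. exact: projT2 (cid (delta_exists j)). Qed.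

Lemma has_csum_kdelta j (f : 'rV[int]_d -> R[i]) :
  has_csum (fun k => kdelta R j k * f k) (f j).
Proof.
move=> e e0; exists [fset j]%fset => G /fsubsetP/(_ j); rewrite inE eqxx => /(_ isT) jG.
under eq_bigr => k _ do rewrite mulrC.
rewrite (_ : \sum_(k <- G) _ = f j) ?subrr ?normc0//.
rewrite (big_fsetD1 j)//= /kdelta eqxx mulr1 big1_seq ?addr0// => k.
by rewrite !inE => /andP[_ /andP[/negPf-> _]]; rewrite mulr0.
Qed.

Lemma conv_delta j (x : cseq R d) : Defs.conv (delta j) x = (fun n => x (n - j)).
Proof.
apply/funext => n; rewrite /Defs.conv deltaE.
exact: (csumE (has_csum_kdelta j (fun k => x (n - k)))).
Qed.

Variable phi : ellspace d q s -> R[i].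
Hypothesis phiP : spectrum d q s phi.

Let phi_lin : scalar phi. Proof. by case: phiP. Qed.
Let phiM (a b c : ellspace d q s) : c = Defs.conv a b :> cseq R d -> phi c = phi a * phi b.
Proof. by case: phiP => _ + _; exact. Qed.

Let phi0 : phi 0 = 0.
Proof. by have := phi_lin (-1) 0 0; rewrite scaler0 add0r mulN1r addNr. Qed.

Let phiZ c a : phi (c *: a) = c * phi a.
Proof. by have := phi_lin c a 0; rewrite addr0 phi0 addr0. Qed.

Let phiD a b : phi (a + b) = phi a + phi b.
Proof. by have := phi_lin 1 a b; rewrite scale1r mul1r. Qed.

Let phiB a b : phi (a - b) = phi a - phi b.
Proof. by rewrite -scaleN1r phiD phiZ mulN1r. Qed.

Let phi_sum (I : Type) (r : seq I) (f : I -> ellspace d q s) :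
  phi (\sum_(i <- r) f i) = \sum_(i <- r) phi (f i).
Proof. by elim: r => [|i r IHr]; rewrite ?big_nil ?phi0// !big_cons phiD IHr. Qed.

Lemma character_delta0 : phi (delta 0) = 1.
Proof.
have [_ _ [a a0]] := phiP; apply: (mulIf a0); rewrite mul1r -(@phiM _ _ a)//.
by rewrite conv_delta; apply/funext => n; rewrite subr0.
Qed.

(** Otherwise b = a / phi a satisfies phi b = 1, and the [q]-th power of its quasi-norm is at most
    1/2. The Neumann series then inverts delta - b, although [phi] vanishes there. *)
Lemma character_bound a M : lqs_le a M -> normc (phi a) `^ q%:num <= 2 * M.
Proof.
move=> aM; rewrite leNgt; apply/negP => phi_gt.
have M0 : 0 <= M by exact: bsum_ge0 aM.
have phin0 : phi a != 0.
  apply: contraTneq phi_gt => ->; rewrite normc0 powR0 ?gt_eqF//.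
  by rewrite -leNgt mulr_ge0.
pose b := (phi a)^-1 *: a; have b1 : phi b = 1 by rewrite phiZ mulVf.
have nb0 k : 0 <= normc (b k) by exact: normc_ge0.
have phiq0 : 0 < normc (phi a) `^ q%:num by apply: le_lt_trans phi_gt; rewrite mulr_ge0.
have bM : lqs_le b 2^-1.
  have h := wsumZ (normc_ge0 (phi a)^-1) (fun k => normc_ge0 (a k)) aM.
  have {}h : lqs_le b ((normc (phi a)^-1) `^ q%:num * M).
    by refine (le_wsum q01 _ h) => k; rewrite nb0 -normcM lexx.
  apply: (bsum_le _ h); rewrite normcV -[(normc _)^-1]powR_inv1 ?normc_ge0//.
  rewrite powRAC powR_inv1 ?powR_ge0//.
  by rewrite mulrC ler_pdivrMr// mulrC ler_pdivlMr// mulrC ltW.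
have bE := wsum_bsum q01 p0 nb0 bM.
(* Since 1/q >= 1, the l^1 norm of [b] is at most 1/2 as well, as the contraction in the sup norm
   requires. *)
have E2 : (2^-1 : R) `^ q%:num^-1 <= 2^-1.
  by apply: ge1r_powR; rewrite ?invf_ge1// invr_gt0 ltr0n/= invf_le1 ?ler1n.
have [c cM ceq] := neumann q01 p0 bE bM E2.
have [c' c'E] := ellspace_mk cM.
suff : phi (delta 0) = phi (delta 0 - b) * phi c'.
  by rewrite phiB character_delta0 b1 subrr mul0r; apply/eqP; rewrite oner_eq0.
apply: phiM; rewrite c'E deltaE; apply/funext => n.
have cX k := wsum_sup q01 p0 k (fun k => normc_ge0 (c k)) cM.
have h1 := has_csum_kdelta 0 (fun k => c (n - k)); rewrite subr0 in h1.
have h2 := has_csumP (bsum_convc bE n cX).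
have := has_csumD h1 (has_csumZ (-1) h2).
rewrite -[csum _]/(Defs.conv b c n) mulN1r => h.
have -> : kdelta R 0 n = c n - Defs.conv b c n by rewrite ceq addrK.
apply/esym/csumE; move: h; congr has_csum; apply/funext => k.
by rewrite [(delta 0 - b) k]ellvalD ellvalN deltaE mulN1r -mulrBl.
Qed.

Lemma character_deltaD j k : phi (delta (j + k)) = phi (delta j) * phi (delta k).
Proof.
apply: phiM; rewrite conv_delta !deltaE; apply/funext => n.
by rewrite /kdelta subr_eq addrC.
Qed.

(** The powers of [phi (delta j)] are the values at the multiples of [j], which [character_bound]
    limits to polynomial growth; a modulus above 1 would force exponential growth. *)
Lemma character_delta_le1 j : normc (phi (delta j)) <= 1.
Proof.
rewrite leNgt; apply/negP => z1; pose x := normc (phi (delta j)) `^ q%:num.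
have x1 : 1 < x.
  have <- : 1 `^ q%:num = 1 :> R by rewrite powR1.
  by rewrite gt0_ltr_powR ?nnegrE ?ler01 ?normc_ge0.
have x0 : 0 < x by exact: lt_trans x1.
have zn (n : nat) : phi (delta (j *+ n)) = phi (delta j) ^+ n.
  elim: n => [|n IHn]; first by rewrite mulr0n expr0 character_delta0.
  by rewrite mulrS character_deltaD IHn exprS.
have normcX (z : R[i]) (n : nat) : normc (z ^+ n) = normc z ^+ n.
  by elim: n => [|n IHn]; rewrite ?expr0 ?normc1// !exprS normcM IHn.
pose L : R := (1 + (onorm j)%:R) `^ p.
have xn (n : nat) : x ^+ n <= 2 * L * (1 + n%:R) `^ p.
  have := character_bound (a := delta (j *+ n)) (M := wt p (j *+ n)).
  rewrite /lqs_le deltaE zn normcX => /(_ (wsum_kdelta p q01 _)) h.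
  rewrite (powR_exprn _ _ (normc_ge0 _)).
  apply: le_trans h _; rewrite -mulrA ler_wpM2l// -powRM ?addr_ge0//.
  rewrite ge0_ler_powR ?nnegrE ?mulr_ge0 ?addr_ge0//.
  have : (onorm (j *+ n))%:R <= n%:R * (onorm j)%:R :> R by rewrite -natrM ler_nat onormMn.
  have : 0 <= n%:R :> R by []. have : 0 <= (onorm j)%:R :> R by [].
  move: (_%:R) (_%:R) (_%:R) => u v w; lra.
(* The exponent p + 1 instead of p leaves a spare factor 1 + n, which would then be bounded, against
   the Archimedean property. *)
have [C HC] : exists C, forall n : nat, (1 + n%:R) `^ (p + 1) * x^-1 ^+ n <= C.
  by apply: poly_geometric_bound; rewrite ?addr_ge0// invr_gt0 x0 invf_lt1.
have LC (n : nat) : 1 + n%:R <= 2 * L * C.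
  have n1 : 0 < 1 + n%:R :> R by rewrite ltr_wpDr.
  have L0 : 0 <= 2 * L by rewrite mulr_ge0 ?powR_ge0.
  apply: le_trans (ler_wpM2l L0 (HC n)).
  rewrite powRD ?(gt_eqF n1) ?implybT// powRr1 ?(ltW n1)//.
  have y0 : 0 < x^-1 ^+ n by rewrite exprn_gt0 ?invr_gt0.
  have xy : x ^+ n * x^-1 ^+ n = 1 by rewrite -exprMn divff ?expr1n ?gt_eqF.
  have := ler_wpM2l (mulr_ge0 (ltW n1) (ltW y0)) (xn n).
  have -> : (1 + n%:R) * x^-1 ^+ n * x ^+ n = 1 + n%:R by rewrite mulrAC -mulrA xy mulr1.
  by move=> h; apply: (le_trans h); rewrite le_eqVlt; apply/orP; left; apply/eqP; ring.
have LC0 : 0 <= 2 * L * C by apply: le_trans (LC 0%N); rewrite addr_ge0.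
have := LC (Num.bound (2 * L * C)); apply/negP; rewrite -ltNge.
by rewrite ltr_wpDl ?archi_boundP.
Qed.

(** The values at [j] and [- j] have product 1, and neither has modulus above 1. *)
Lemma normc_character_delta j : normc (phi (delta j)) = 1.
Proof.
have h : normc (phi (delta j)) * normc (phi (delta (- j))) = 1.
  by rewrite -normcM -character_deltaD subrr character_delta0 normc1.
apply/eqP; rewrite eq_le character_delta_le1/= -h.
by rewrite ler_piMr ?normc_ge0 ?character_delta_le1.
Qed.

(** Choose 2 pi t_i as an argument of the value at the i-th basis vector. Both sides are
    homomorphisms from the lattice to the nonzero complex numbers, and they agree on the basis. *)
Lemma character_deltaE : exists t : 'rV[R]_d, forall n,
  phi (delta n) = expi (2 * pi * \sum_i (n 0 i)%:~R * t 0 i).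
Proof.
have th (i : 'I_d) : exists x, phi (delta (delta_mx 0 i)) = expi x.
  exact/expi_surj/normc_character_delta.
pose t : 'rV[R]_d := \row_i (projT1 (cid (th i)) / (2 * pi)).
exists t; pose chi n : R[i] := expi (2 * pi * \sum_i (n 0 i)%:~R * t 0 i).
have pi2 : 2 * pi != 0 :> R by rewrite mulf_neq0 ?gt_eqF ?pi_gt0.
have chi0 : chi 0 = 1.
  by rewrite /chi big1 ?mulr0 ?expi0// => i _; rewrite mxE mul0r.
have chiD m n : chi (m + n) = chi m * chi n.
  rewrite /chi -expiD -mulrDr -big_split/=; congr (expi (_ * _)).
  by apply: eq_bigr => i _; rewrite mxE rmorphD/= mulrDl.
have chiN m : chi (- m) = (chi m)^-1.
  rewrite /chi -expiN -mulrN -sumrN; congr (expi (_ * _)).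
  by apply: eq_bigr => i _; rewrite mxE rmorphN/= mulNr.
have dN m : phi (delta (- m)) = (phi (delta m))^-1.
  have m0 : phi (delta m) != 0.
    by apply: contra_eq_neq (normc_character_delta m) => ->; rewrite normc0 eq_sym oner_eq0.
  by apply: (mulfI m0); rewrite -character_deltaD subrr character_delta0 divff.
have chie i : phi (delta (delta_mx 0 i)) = chi (delta_mx 0 i).
  rewrite /chi (bigD1 i)//= big1 => [|j ji]; last by rewrite mxE eqxx (negPf ji) mul0r.
  rewrite addr0 !mxE !eqxx mul1r mulrC divfK//.
  exact: projT2 (cid (th i)).
have chieM i (m : nat) : phi (delta (delta_mx 0 i *+ m)) = chi (delta_mx 0 i *+ m).
  elim: m => [|m IHm]; first by rewrite mulr0n character_delta0 chi0.
  by rewrite mulrS character_deltaD chiD chie IHm.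
move=> n; rewrite -/(chi n) [n]row_sum_delta.
elim/big_rec : _ => [|i x _ IHx]; first by rewrite character_delta0 chi0.
rewrite character_deltaD chiD IHx; congr (_ * _).
case: (n 0 i) => m; first by rewrite -[Posz m]intz -pmulrn scaler_nat chieM.
by rewrite NegzE scaleNr -[Posz _]intz -pmulrn scaler_nat dN chiN chieM.
Qed.

(** Subtract from [a] its restriction to a large finite set: on the finitely supported part [phi] is
    evaluation at [t], and [character_bound] controls the remainder. *)
Lemma character_torus : range (torus_char q s) phi.
Proof.
have [t phit] := character_deltaE; exists t => //; apply/funext => a.
apply: csumE => e e0; have [M aM] := ellspaceP a.
(* With this [w], the [q]-th power of the modulus of [phi] on the remainder is at most 2 w = (e /
   2)^q. *)
pose w := (e / 2) `^ q%:num / 2.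
have w0 : 0 < w by rewrite divr_gt0 ?powR_gt0 ?divr_gt0.
have t0 k : 0 <= normc (a k) `^ q%:num * wt p k by rewrite mulr_ge0 ?powR_ge0.
have [F HF] := bsum_tail t0 aM w0.
exists F => G FG; pose z := a - \sum_(k <- G) a k *: delta k.
have zk k : z k = if k \in G then 0 else a k.
  have -> : z k = a k - \sum_(j <- G) (a j *: delta j) k by rewrite -sum_ellval.
  under eq_bigr => j _ do rewrite [_ k]/(a j * (delta j : cseq R d) k) deltaE.
  by rewrite sum_kdelta; case: ifP; rewrite ?subrr ?subr0.
have zw : lqs_le z w.
  apply: le_bsum HF => k; rewrite zk; case: ifPn => kG.
    by rewrite normc0 powR0 ?gt_eqF// mul0r; case: ifP.
  by rewrite ifN//; apply: contra kG; apply/fsubsetP.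
have phiz : phi z = phi a - \sum_(k <- G) a k * expi (2 * pi * \sum_i (k 0 i)%:~R * t 0 i).
  by rewrite phiB phi_sum; congr (_ - _); apply: eq_bigr => k _; rewrite phiZ phit.
rewrite -phiz; have := character_bound zw; rewrite /w mulrC divfK// => h.
apply: (@le_lt_trans _ _ (e / 2)); last by rewrite gtr_pMr// invf_lt1// ltr1n.
rewrite leNgt; apply: contraTN h => h; rewrite -ltNge.
by rewrite gt0_ltr_powR ?nnegrE ?normc_ge0 ?divr_ge0 ?(ltW e0).
Qed.

End characters.

Theorem theorem1p1 (R : realType) (d : nat) (q : {posnum R}) (s : R)
    (hd : (0 < d)%N) (hq : q%:num < 1) (hs : 0 <= s) :
  let B : set (cseq R d) := ell d q%:num s in
  (inverse_closed (conv_ops B) (bounded_ops R d) <->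
   inverse_closed (convdom_ops B) (bounded_ops R d)) /\
  (inverse_closed (convdom_ops B) (bounded_ops R d) <->
   spectrum d q s `<=` range (torus_char q s)).
Proof.
have q01 : 0 < q%:num <= 1 by rewrite gt0 ltW.
have i := conv_ops_inverse_closed (d := d) q01 hs.
have ii := convdom_ops_inverse_closed (d := d) q01 hs.
by split; split=> // _ phi phiP; exact: (character_torus (ltW hq) hs phiP).
Qed.
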